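(* There is an absolute constant $C_1>0$ such that, writing $C_{1,\beta}=2^{-1/2}C_1(\beta^{-1}+1)$ for $\beta>0$, the following holds for $d=1$. Let $\alpha,\beta>0$ and $0<R_{ks}\le\dfrac{19}{20}\left(\dfrac{\alpha^{1/8}}{\sqrt[4]{240\,C_{1,\beta}}}\right)$. If $f_0\in\mathcal{M}_{\alpha,\beta}$ is non-negative and $\|f_0\|_{\alpha,\beta}\le R_{ks}$, then the 6-wave kinetic equation with initial data $f_0$ has a unique non-negative mild solution.
   Context: Here $d=1$, $t\in\mathbb{R}$, $x,v\in\mathbb{R}^d$. ''Measurable'' means Borel measurable; functions of $(t,x,v)$ are jointly measurable. Spaces. $\mathcal{M}_{\alpha,\beta}$ is the space of measurable $g:\mathbb{R}^d\times\mathbb{R}^d\to\mathbb{R}$ with $\|g\|_{\alpha,\beta}:=\sup_{x,v}|g(x,v)|e^{\alpha|x|^2+\beta|v|^2}<\infty$. $L^\infty(\mathbb{R},\mathcal{M}_{\alpha,\beta})$ is the space of time-dependent functions $g(t,x,v)$ with $|||g|||_{\alpha,\beta}:=\sup_{t\in\mathbb{R}}\|g(t)\|_{\alpha,\beta}<\infty$. Transport. $(T^sg)(t,x,v):=g(t,x-sv,v)$. So $T^{-t}f(t)$ is the function $(x,v)\mapsto f(t,x+tv,v)$, and $T^{-s}\mathcal{C}_6[f](s,x,v)=\mathcal{C}_6[f](s,x+sv,v)$. Equation. The 6-wave kinetic equation with initial data $f_0$ is $\partial_tf+v\cdot\nabla_xf=\mathcal{C}_6[f]$, $f(t=0)=f_0$,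 where $$\mathcal{C}_6[f](t,x,v)=\int_{\mathbb{R}^{5d}}\delta(\Sigma)\delta(\Omega)\Big[f_3f_4f_5(ff_1+ff_2+f_1f_2)-ff_1f_2(f_3f_4+f_3f_5+f_4f_5)\Big]dv_1\cdots dv_5,$$ $f=f(t,x,v)$, $f_i=f(t,x,v_i)$, $\Sigma=v+v_1+v_2-v_3-v_4-v_5$, $\Omega=|v|^2+|v_1|^2+|v_2|^2-|v_3|^2-|v_4|^2-|v_5|^2$. Meaning of the deltas: $\delta(\Sigma)$ sets $v_5=v+v_1+v_2-v_3-v_4$; then, for fixed $v,v_1,v_2$, with $h(v_3,v_4)$ denoting $\Omega$ after this substitution, $\int_{\mathbb{R}^{2d}}\delta(h)F\,dv_3dv_4:=\int_{\{h=0\}}\frac{F}{|\nabla h|}\,d\mathcal{H}^{2d-1}$ (surface measure on the zero set of $h$ in $\mathbb{R}^{2d}$). Mild solution. For $f_0\in\mathcal{M}_{\alpha,\beta}$, a measurable $f:\mathbb{R}\times\mathbb{R}^d\times\mathbb{R}^d\to\mathbb{R}$ is a mild solution with initial data $f_0$ if $T^{-t}f(t)\in L^\infty(\mathbb{R},\mathcal{M}_{\alpha,\beta})$ and $T^{-t}f(t,x,v)=f_0(x,v)+\int_0^tT^{-s}\mathcal{C}_6[f](s,x,v)\,ds$ for all $t\in\mathbb{R}$.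
   Formalization: Non-negativity of the mild solution is required only for t ≥ 0; non-negativity for all real t fails, e.g. for f_0 a small multiple of the indicator of |x|≤1, |v|≤1. The solution and the mild equation are still for all t in R, and uniqueness is among mild solutions non-negative for t ≥ 0. *)

(* Defs.v *)
From HB Require Import structures.
From mathcomp Require Import all_boot all_order all_algebra.
From mathcomp Require Import all_classical all_reals all_analysis.
From mathcomp Require Import measurable_realfun ring lra.

Set Implicit Arguments.
Unset Strict Implicit.
Unset Printing Implicit Defensive.
Import Order.TTheory GRing.Theory Num.Theory.
Import numFieldNormedType.Exports.

Local Open Scope classical_set_scope.
Local Open Scope ring_scope.

Section Hausdorff.
Context {R : realType}.
Implicit Types (p q : R * R) (A B X : set (R * R)) (delta : R).

(* The canonical norm of [R * R] is the sup norm, so the Euclidean distance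
   has to be introduced by hand. *)
Definition edist p q : R :=
  Num.sqrt ((p.1 - q.1) ^+ 2 + (p.2 - q.2) ^+ 2).

(* The element [0] only matters for [A = set0], whose supremum would be [-oo]. *)
Definition ediam A : \bar R :=
  ereal_sup (0%E |` [set (edist p q)%:E | p in A & q in A]).

Definition hausdorff1_pre delta A : \bar R :=
  ereal_inf [set (\sum_(n <oo) ediam (U n))%E | U in
    [set U : (set (R * R))^nat |
      A `<=` \bigcup_n U n /\ forall n, (ediam (U n) <= delta%:E)%E]].

Definition hausdorff1 A : \bar R :=
  ereal_sup [set hausdorff1_pre delta A | delta in [set delta | 0 < delta]].

Lemma ediam_ge0 A : (0 <= ediam A)%E.
Proof. by apply: ereal_sup_ubound; left. Qed.

Lemma ediam0 : ediam set0 = 0%E.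
Proof.
apply/eqP; rewrite eq_le ediam_ge0 andbT; apply: ge_ereal_sup.
by move=> x /= [->//|[p []]].
Qed.

Lemma edist_le_ediam A p q : A p -> A q -> ((edist p q)%:E <= ediam A)%E.
Proof. by move=> Ap Aq; apply: ereal_sup_ubound; right; exists p => //; exists q. Qed.

Lemma edist_fst p q : `|p.1 - q.1| <= edist p q.
Proof. by rewrite -sqrtr_sqr ler_wsqrtr// lerDl sqr_ge0. Qed.

Lemma edist_snd p q : `|p.2 - q.2| <= edist p q.
Proof. by rewrite -sqrtr_sqr ler_wsqrtr// lerDr sqr_ge0. Qed.

Lemma hausdorff1_pre_ge0 delta A : (0 <= hausdorff1_pre delta A)%E.
Proof.
apply: le_ereal_inf_tmp => _ [U _ <-]; apply: nneseries_ge0 => n _ _.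
exact: ediam_ge0.
Qed.

Lemma hausdorff1_pre_anti delta delta' A : delta <= delta' ->
  (hausdorff1_pre delta' A <= hausdorff1_pre delta A)%E.
Proof.
move=> dd'; apply: ereal_inf_le_tmp => _ [U [AU dU] <-]; exists U => //; split=> //.
by move=> n; rewrite (le_trans (dU n))// lee_fin.
Qed.

Lemma hausdorff1_pre_le delta A : 0 < delta ->
  (hausdorff1_pre delta A <= hausdorff1 A)%E.
Proof. by move=> d0; apply: ereal_sup_ubound; exists delta. Qed.

Let cost delta A : \bar R := if (ediam A <= delta%:E)%E then ediam A else +oo%E.

Let cost_ge0 delta A : (0 <= cost delta A)%E.
Proof. by rewrite /cost; case: ifP => // _; exact: ediam_ge0. Qed.

Let S := g_sigma_algebraType [set: set (R * R)].

Let hausdorff1_preE delta : hausdorff1_pre delta =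
  mu_ext (cost delta : set S -> \bar R).
Proof.
apply/funext => A; apply/eqP; rewrite eq_le; apply/andP; split.
- apply: le_ereal_inf_tmp => _ [U [_ AU] <-].
  have [dU|] := pselect (forall n, (ediam (U n) <= delta%:E)%E).
    apply: ereal_inf_lbound; exists U => //.
    by apply: eq_eseriesr => n _; rewrite /cost dU.
  move=> /existsNP[n /negP/negbTE dU].
  rewrite (@eseries_pinfty _ _ _ n) ?leey//.
    by move=> k _; rewrite -ltNye (lt_le_trans _ (cost_ge0 _ _)).
  by rewrite /cost dU.
- apply: le_ereal_inf_tmp => _ [U [AU dU] <-]; apply: ereal_inf_lbound.
  exists U; first by split=> // n; exact: sub_sigma_algebra.
  by apply: eq_eseriesr => n _; rewrite /cost dU.
Qed.

Let hausdorff1_pre_subadd delta : sigma_subadditive (hausdorff1_pre delta).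
Proof.
rewrite hausdorff1_preE.
exact: (@mu_ext_sigma_subadditive _ S R (cost delta) (cost_ge0 delta)).
Qed.

Lemma hausdorff1_ge0 A : (0 <= hausdorff1 A)%E.
Proof. exact: le_trans (hausdorff1_pre_ge0 1 A) (hausdorff1_pre_le A ltr01). Qed.

Lemma hausdorff1_set0 : hausdorff1 set0 = 0%E.
Proof.
apply/eqP; rewrite eq_le hausdorff1_ge0 andbT; apply: ge_ereal_sup.
move=> _ [delta /= d0 <-]; apply: ereal_inf_lbound; exists (fun=> set0).
  by split=> // n; rewrite ediam0 lee_fin ltW.
by rewrite eseries0// => n _ _; rewrite ediam0.
Qed.

Lemma le_hausdorff1 : {homo hausdorff1 : A B / A `<=` B >-> (A <= B)%E}.
Proof.
move=> A B AB; apply: ge_ereal_sup => _ [delta /= d0 <-].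
apply: le_trans (hausdorff1_pre_le B d0).
apply: ereal_inf_le_tmp => _ [U [BU dU] <-]; exists U => //; split=> //.
exact: subset_trans BU.
Qed.

Lemma hausdorff1_sigma_subadditive : sigma_subadditive hausdorff1.
Proof.
move=> F; apply: ge_ereal_sup => _ [delta /= d0 <-].
apply: le_trans (hausdorff1_pre_subadd _ _) _; apply: lee_nneseries => n _.
  by move=> _; exact: hausdorff1_pre_ge0.
exact: hausdorff1_pre_le.
Qed.

HB.instance Definition _ := isOuterMeasure.Build R (R * R)%type hausdorff1
  hausdorff1_set0 hausdorff1_ge0 le_hausdorff1 hausdorff1_sigma_subadditive.

Let hausdorff1_pre_separated e delta A B : delta < e ->
  (forall p q, A p -> B q -> e <= edist p q) ->
  (hausdorff1_pre delta A + hausdorff1_pre delta B <=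
   hausdorff1_pre delta (A `|` B))%E.
Proof.
move=> de sepAB; apply: le_ereal_inf_tmp => _ [U [ABU dU] <-].
pose V (C : set (R * R)) n := if `[< U n `&` C !=set0 >] then U n else set0.
have VC C : C `<=` A `|` B -> (hausdorff1_pre delta C <=
    \sum_(n <oo) ediam (V C n))%E.
  move=> CAB; apply: ereal_inf_lbound; exists (V C) => //; split.
    move=> p Cp; have [n _ Unp] := ABU _ (CAB _ Cp); exists n => //.
    by rewrite /V; case: asboolP => // -[]; exists p.
  move=> n; rewrite /V; case: asboolP => // _; rewrite ediam0.
  exact: le_trans (ediam_ge0 (U n)) (dU n).
apply: (@le_trans _ _ (\sum_(n <oo) (ediam (V A n) + ediam (V B n)))%E).
  rewrite nneseriesD; last 2 first.
  - by move=> *; exact: ediam_ge0.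
  - by move=> *; exact: ediam_ge0.
  by apply: leeD; apply: VC; [left|right].
apply: lee_nneseries => n _.
  by move=> _; rewrite adde_ge0// ediam_ge0.
rewrite /V; case: asboolP => [[p [Up Ap]]|_]; last first.
  by rewrite ediam0 add0e; case: asboolP; rewrite // ediam0 ediam_ge0.
case: asboolP => [[q [Uq Bq]]|_]; last by rewrite ediam0 adde0.
have := le_trans (edist_le_ediam Up Uq) (dU n); rewrite lee_fin => pqd.
by have := le_lt_trans (le_trans (sepAB _ _ Ap Bq) pqd) de; rewrite ltxx.
Qed.

Lemma hausdorff1_separated e A B : 0 < e ->
  (forall p q, A p -> B q -> e <= edist p q) ->
  (hausdorff1 A + hausdorff1 B <= hausdorff1 (A `|` B))%E.
Proof.
move=> e0 sepAB; set M := hausdorff1 (A `|` B).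
have [->|Moo] := eqVneq M +oo%E; first by rewrite leey.
have fin_le (x : \bar R) : (0 <= x -> x <= M -> x \is a fin_num)%E.
  move=> x0 xM; rewrite ge0_fin_numE// (le_lt_trans xM)// ltey//.
have preM d1 d2 : 0 < d1 -> 0 < d2 ->
    (hausdorff1_pre d1 A + hausdorff1_pre d2 B <= M)%E.
  move=> d10 d20; pose m := Num.min (Num.min d1 d2) (e / 2).
  have m0 : 0 < m by rewrite !lt_min d10 d20 divr_gt0.
  have me : m < e.
    rewrite (@le_lt_trans _ _ (e / 2))// ?ge_min ?lexx ?orbT//.
    by rewrite ltr_pdivrMr// ltr_pMr// ltr1n.
  apply: le_trans (hausdorff1_pre_le _ m0).
  apply: le_trans (hausdorff1_pre_separated me sepAB).
  by apply: leeD; apply: hausdorff1_pre_anti; rewrite !ge_min lexx ?orbT.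
have HA : hausdorff1 A \is a fin_num.
  by apply: fin_le; [exact: hausdorff1_ge0|apply: le_hausdorff1; left].
rewrite -leeBrDl//; apply: ge_ereal_sup => _ [d2 /= d20 <-].
have HB : hausdorff1_pre d2 B \is a fin_num.
  apply: fin_le; first exact: hausdorff1_pre_ge0.
  by apply: le_trans (hausdorff1_pre_le _ d20) _; apply: le_hausdorff1; right.
rewrite leeBrDl// -leeBrDr//; apply: ge_ereal_sup => _ [d1 /= d10 <-].
by rewrite leeBrDr//; exact: preM.
Qed.

Lemma hausdorff1_halfplane (pi : R * R -> R) c :
  (forall p q, `|pi p - pi q| <= edist p q) ->
  hausdorff1.-caratheodory [set p | c < pi p].
Proof.
move=> pi_lip; apply: le_caratheodory_measurable => X /=; set B := [set p | _].
have [->|Xoo] := eqVneq (hausdorff1 X) +oo%E; first by rewrite leey.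
pose a n : R := c + n.+1%:R^-1.
have a_gt n : c < a n by rewrite ltrDl invr_gt0.
have a_lt m n : (m < n)%N -> a n < a m.
  by move=> mn; rewrite ltrD2l ltf_pV2 ?posrE// ltr_nat.
pose F n := X `&` [set p | a n <= pi p].
pose D n := X `&` [set p | a n.+2 <= pi p < a n.+1].
have sep s t (P Q : set (R * R)) : t < s -> P `<=` [set p | s <= pi p] ->
    Q `<=` [set p | pi p <= t] ->
    (hausdorff1 P + hausdorff1 Q <= hausdorff1 (P `|` Q))%E.
  move=> ts Ps Qt; apply: (@hausdorff1_separated (s - t)); first by rewrite subr_gt0.
  move=> p q /Ps /= sp /Qt /= qt; apply: le_trans (pi_lip p q).
  by apply: le_trans (ler_norm _); exact: lerB.
have FX n : (hausdorff1 (F n) <= hausdorff1 X)%E by by apply: le_hausdorff1 => p [].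
have D_sum n : (\sum_(0 <= k < n) hausdorff1 (D k) <=
    hausdorff1 (F n) + hausdorff1 (F n.+1))%E.
  elim: n => [|n IHn].
    by rewrite big_geq// adde_ge0// hausdorff1_ge0.
  rewrite big_nat_recr//=; apply: le_trans (leeD IHn (lexx _)) _.
  rewrite addeAC addeC leeD2l//.
  apply: (le_trans (sep (a n) (a n.+1) _ _ _ _ _)).
  - exact: a_lt.
  - by move=> p [].
  - by move=> p [_ /= /andP[_ /ltW]].
  apply: le_hausdorff1 => p [[Xp /= pn]|[Xp /= /andP[pn _]]]; split=> //=.
  by apply: le_trans pn; apply/ltW/a_lt.
have D_fin : (\sum_(0 <= k <oo) hausdorff1 (D k) < +oo)%E.
  apply: (@le_lt_trans _ _ (hausdorff1 X + hausdorff1 X)%E); last first.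
    by rewrite lte_add_pinfty// ltey.
  apply: lime_le.
    by apply: is_cvg_nneseries => n _ _; exact: hausdorff1_ge0.
  apply: nearW => n; apply: le_trans (D_sum n) _.
  by apply: leeD.
have tail0 := nneseries_tail_cvg D_fin (fun k _ => hausdorff1_ge0 (D k)).
have le_tail n : (hausdorff1 (X `&` B) + hausdorff1 (X `&` ~` B) <=
    hausdorff1 X + \sum_(n <= k <oo) hausdorff1 (D k))%E.
  have XB : X `&` B `<=` F n.+1 `|` \bigcup_(k in ~` `I_n) D k.
    move=> p [Xp /= cp].
    have /ex_minnP[m am amin] : exists m, a m <= pi p.
      have := ltr_add_invr cp => -[k /ltW ?]; by exists k.
    have [mn|nm] := leqP m n.+1.
      left; split=> //=; apply: le_trans am.
      by move: mn; rewrite leq_eqVlt => /predU1P[->//|/a_lt/ltW].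
    right; exists m.-2.
      by move=> /=; case: m nm {am amin} => [|[|m]]//=; rewrite !ltnS => ? ; apply/negP; rewrite -leqNgt.
    case: m nm am amin => [|[|m]]//= _ am amin; split=> //=.
    rewrite am /= ltNge; apply/negP => /amin; by rewrite ltnn.
  apply: (@le_trans _ _ ((hausdorff1 (F n.+1) +
      \sum_(n <= k <oo) hausdorff1 (D k)) + hausdorff1 (X `&` ~` B))%E).
    rewrite leeD2r//; apply: le_trans (le_hausdorff1 XB) _.
    apply: le_trans (outer_measureU2 _ _ _) _; rewrite leeD2l//.
    exact: outer_measure_sigma_subadditive_tail.
  rewrite addeAC leeD2r//; apply: le_trans (sep (a n.+1) c _ _ _ _ _) _ => //.
  - by move=> p [].
  - by move=> p [_ /= /negP]; rewrite -leNgt.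
  by apply: le_hausdorff1 => p [] [].
have tailX : ((hausdorff1 X + \sum_(n <= k <oo) hausdorff1 (D k))%E
    @[n --> \oo] --> (hausdorff1 X + 0)%E).
  apply: cvgeD => //; last exact: cvg_cst.
  exact: fin_num_adde_defl.
rewrite -[leRHS]adde0 -(cvg_lim _ tailX)//; apply: lime_ge.
  by apply/cvg_ex; eexists; exact: tailX.
exact: nearW.
Qed.

Let measurable_fun_lip (pi : R * R -> R) :
  (forall p q, `|pi p - pi q| <= edist p q) ->
  forall Y : set R, measurable Y -> hausdorff1.-caratheodory (pi @^-1` Y).
Proof.
move=> pi_lip.
suff mpi : measurable_fun setT (pi : caratheodory_type hausdorff1 -> R).
  by move=> Y mY; have := mpi measurableT _ mY; rewrite setTI.
apply: (measurability _ (RGenOInfty.measurableE R)) => _ [_ [c ->] <-].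
rewrite setTI (_ : _ @^-1` _ = [set p | c < pi p]).
  exact: hausdorff1_halfplane.
by apply/seteqP; split=> p /=; rewrite in_itv/= andbT.
Qed.

Lemma borel_caratheodory_hausdorff1 A :
  measurable A -> hausdorff1.-caratheodory A.
Proof.
apply: smallest_sub.
  exact: (@sigma_algebra_measurable _ (caratheodory_type hausdorff1)).
move=> _ [] [Y mY <-]; rewrite setTI.
- exact: measurable_fun_lip edist_fst _ mY.
- exact: measurable_fun_lip edist_snd _ mY.
Qed.

Let hausdorff1_semi_sigma_additive :
  semi_sigma_additive (hausdorff1 : set (R * R) -> \bar R).
Proof.
move=> F mF tF mUF.
apply: (@caratheodory_measure_sigma_additive R _ hausdorff1 F _ tF).
- by move=> n; exact: borel_caratheodory_hausdorff1.
- exact: borel_caratheodory_hausdorff1.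
Qed.

HB.instance Definition _ := isMeasure.Build _ (R * R)%type R hausdorff1
  hausdorff1_set0 hausdorff1_ge0 hausdorff1_semi_sigma_additive.

End Hausdorff.

Section Equation.
Context {R : realType}.
Implicit Types (alpha beta s t x v : R) (f : R -> R -> R -> R).

Definition weight alpha beta x v : R := expR (alpha * x ^+ 2 + beta * v ^+ 2).

Definition normM alpha beta (g : R -> R -> R) : \bar R :=
  ereal_sup [set (`|g z.1 z.2| * weight alpha beta z.1 z.2)%:E | z in [set: R * R]].

Definition inM alpha beta (g : R -> R -> R) : Prop :=
  measurable_fun [set: R * R] (fun z => g z.1 z.2) /\
  (normM alpha beta g < +oo)%E.

Definition jointly_measurable f : Prop :=
  measurable_fun [set: R * R * R] (fun z => f z.1.1 z.1.2 z.2).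

Definition normLinfM alpha beta f : \bar R :=
  ereal_sup [set normM alpha beta (f t) | t in [set: R]].

Definition inLinfM alpha beta f : Prop :=
  jointly_measurable f /\ (normLinfM alpha beta f < +oo)%E.

Definition transport s f : R -> R -> R -> R := fun t x v => f t (x - s * v) v.

Definition Omega (v v1 v2 v3 v4 v5 : R) : R :=
  v ^+ 2 + v1 ^+ 2 + v2 ^+ 2 - v3 ^+ 2 - v4 ^+ 2 - v5 ^+ 2.

(* The value of [v5] imposed by [delta(Sigma)]. *)
Definition v5_of (v v1 v2 v3 v4 : R) : R := v + v1 + v2 - v3 - v4.

Definition resonance (v v1 v2 : R) (w : R * R) : R :=
  Omega v v1 v2 w.1 w.2 (v5_of v v1 v2 w.1 w.2).

Definition gradient_norm (h : R * R -> R) (w : R * R) : R :=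
  Num.sqrt (derive1 (fun u => h (u, w.2)) w.1 ^+ 2
          + derive1 (fun u => h (w.1, u)) w.2 ^+ 2).

(* At a critical point of [h] the integrand is [0]; for [h = resonance v v1 v2]
   this happens on [h = 0] only when [h = 0] is a single point, which is
   [hausdorff1]-negligible. *)
Definition delta_integral (h F : R * R -> R) : R :=
  \int[hausdorff1]_(w in [set w | h w = 0]) (F w / gradient_norm h w).

Definition C6_integrand (fv f1 f2 f3 f4 f5 : R) : R :=
  f3 * f4 * f5 * (fv * f1 + fv * f2 + f1 * f2)
  - fv * f1 * f2 * (f3 * f4 + f3 * f5 + f4 * f5).

Definition C6 f : R -> R -> R -> R := fun t x v =>
  \int[(lebesgue_measure \x lebesgue_measure)%E]_u
    delta_integral (resonance v u.1 u.2) (fun w =>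
      C6_integrand (f t x v) (f t x u.1) (f t x u.2)
        (f t x w.1) (f t x w.2) (f t x (v5_of v u.1 u.2 w.1 w.2))).

Definition integral0 (g : R -> R) t : R :=
  if 0 <= t then \int[lebesgue_measure]_(s in `[0, t]) g s
  else - \int[lebesgue_measure]_(s in `[t, 0]) g s.

Definition mild_solution alpha beta (f0 : R -> R -> R) f : Prop :=
  [/\ jointly_measurable f,
      inLinfM alpha beta (fun t => transport (- t) f t) &
      forall t x v, transport (- t) f t x v =
        f0 x v + integral0 (fun s => transport (- s) (C6 f) s x v) t].

(* Non-negativity is required forward in time only. For [t < 0] the gain and
   loss terms of the equation exchange their roles, and no mild solution
   stays non-negative if, e.g., [f0] is a positive multiple of the indicator function
   of [-1, 1] x [-1, 1]. *)
Definition nonnegative_solution f : Prop :=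
  forall t x v, 0 <= t -> 0 <= f t x v.

Definition C1_beta (C1 beta : R) : R := 2 `^ (- 2^-1) * C1 * (beta^-1 + 1).

End Equation.

(* Main.v *)
(* For fixed (v, v1, v2) the resonant set is an ellipse, the image of one fixed
   ellipse under a homothety of ratio r; since the gradient of the constraint
   also scales like r and Hausdorff measure scales like r, the delta integral is
   an integral against a fixed finite measure.  This gives both measurability of
   the collision operator and uniform bounds.

   With W(v) = exp(- alpha |x - t v|^2 - beta |v|^2), conservation of momentum
   and energy gives W W1 W2 = W3 W4 W5, so every quintic term of a difference
   C6[f] - C6[g] is at most a constant times M^4 D W W1 W2.  Integrating out v1
   and v2 costs (\int W)^2 <= pi / (beta + alpha t^2), which is integrable in
   time with integral pi / sqrt(alpha beta).  For small data the Duhamel map is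
   thus a contraction on all of R; uniqueness needs no smallness, by an
   exponential weight in time.

   Positivity: for t >= 0 solve the equation with f replaced by its positive
   part inside C6.  Where f <= 0 only a gain term survives, so f cannot become
   negative, and the truncation is invisible a posteriori. *)

Require Import Defs.
From mathcomp Require Import all_boot all_order all_algebra.
From mathcomp Require Import all_classical all_reals all_analysis.
From mathcomp Require Import measurable_realfun ring lra.

Set Implicit Arguments.
Unset Strict Implicit.
Unset Printing Implicit Defensive.
Import Order.TTheory GRing.Theory Num.Theory.
Import numFieldNormedType.Exports.
Local Open Scope classical_set_scope.
Local Open Scope ring_scope.

(** * Hausdorff measure under Lipschitz maps and homotheties *)

Section HausdorffLipschitz.
Context {R : realType}.
Implicit Types (p q : R * R) (A : set (R * R)) (c : R).

Local Notation H1 := (hausdorff1 : set (R * R) -> \bar R).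
Local Notation edist := Defs.edist.

Lemma ediam_image_le (psi : R * R -> R * R) c A : 0 <= c ->
  (forall p q, A p -> A q -> edist (psi p) (psi q) <= c * edist p q) ->
  (ediam (psi @` A) <= c%:E * ediam A)%E.
Proof.
move=> c0 psic; apply: ge_ereal_sup => x /= [->|[_ [p Ap <-]] [_ [q Aq <-]] <-].
  by rewrite mule_ge0// ?lee_fin// ediam_ge0.
apply: (@le_trans _ _ (c%:E * (edist p q)%:E)%E).
  by rewrite -EFinM lee_fin psic.
by rewrite lee_wpmul2l ?lee_fin// edist_le_ediam.
Qed.

(** A cover of [A] of mesh [delta / c] is carried to a cover of the image of mesh [delta], each
    diameter growing by a factor at most [c]. *)
Lemma hausdorff1_image_le (psi : R * R -> R * R) c A : 0 < c ->
  (forall p q, A p -> A q -> edist (psi p) (psi q) <= c * edist p q) ->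
  (H1 (psi @` A) <= c%:E * H1 A)%E.
Proof.
move=> c0 psic; apply: ge_ereal_sup => _ [delta /= d0 <-].
have dc0 : 0 < delta / c by rewrite divr_gt0.
apply: (@le_trans _ _ (c%:E * hausdorff1_pre (delta / c) A)%E); last first.
  by rewrite lee_wpmul2l ?lee_fin ?(ltW c0)// hausdorff1_pre_le.
rewrite -lee_pdivrMl//; apply: le_ereal_inf_tmp => _ [U [AU dU] <-].
rewrite lee_pdivrMl//.
(* The Lipschitz bound is available on [A] only, so each covering set is cut down to its trace on
   [A] before being mapped. *)
have UA n : (ediam (psi @` (U n `&` A)) <= c%:E * ediam (U n))%E.
  apply: (@le_trans _ _ (c%:E * ediam (U n `&` A))%E).
    by apply: ediam_image_le; [exact: ltW|move=> p q [_ ?] [_ ?]; exact: psic].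
  rewrite lee_wpmul2l ?lee_fin ?(ltW c0)//; apply: ge_ereal_sup.
  move=> x /= [->|[p [Up _]] [q [Uq _]] <-]; first exact: ediam_ge0.
  exact: edist_le_ediam.
rewrite -nneseriesZl; last by move=> n _; exact: ediam_ge0.
apply: (@le_trans _ _ (\sum_(n <oo) ediam (psi @` (U n `&` A)))%E); last first.
  apply: lee_nneseries => [n _ _|n _]; first exact: ediam_ge0.
  exact: UA.
apply: ereal_inf_lbound; exists (fun n => psi @` (U n `&` A)) => //; split.
  move=> _ [p Ap <-]; have [n _ Up] := AU _ Ap; exists n => //.
  by exists p.
move=> n; apply: le_trans (UA n) _.
rewrite -lee_pdivlMl// -EFinM mulrC; exact: dU.
Qed.

(** Cutting into equal pieces gives covers of arbitrarily small mesh whose diameters add up to at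
    most [a]. *)
Lemma hausdorff1_segment_le (a : R) : 0 < a ->
  (H1 [set p : R * R | ((0 <= p.1 <= a) /\ p.2 = 0)%R] <= a%:E)%E.
Proof.
move=> a0; apply: ge_ereal_sup => _ [delta /= d0 <-].
have [N aN] : exists N : nat, a / N.+1%:R <= delta.
  exists (Num.trunc (a / delta)).
  rewrite ler_pdivrMr// mulrC -ler_pdivrMr//; apply/ltW.
  by have /andP[] := truncn_itv (divr_ge0 (ltW a0) (ltW d0)).
pose st := a / N.+1%:R.
pose U n : set (R * R) := if (n < N.+1)%N then
  [set p : R * R | n%:R * st <= p.1 <= n.+1%:R * st /\ p.2 = 0] else set0.
have st0 : 0 < st by rewrite divr_gt0.
have dU n : (ediam (U n) <= st%:E)%E.
  rewrite /U; case: ifPn => [nN|_]; last by rewrite ediam0 lee_fin ltW.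
  apply: ge_ereal_sup => x /= [->|]; first by rewrite lee_fin ltW.
  move=> [p [/andP[p1 p2] p0]] [q [/andP[q1 q2] q0] <-].
  rewrite lee_fin /edist p0 q0 subrr expr0n/= addr0 sqrtr_sqr.
  rewrite ler_norml; move: p2 q2; rewrite -natr1 mulrDl mul1r => p2 q2.
  by apply/andP; split; lra.
apply: (@le_trans _ _ (\sum_(n <oo) ediam (U n))%E).
  apply: ereal_inf_lbound; exists U => //; split; last first.
    by move=> n; apply: le_trans (dU n) _; rewrite lee_fin.
  move=> p [/andP[p1 pa] p2].
  (* At the right end point the truncated quotient would be [N.+1], one past the last piece; that
     point is assigned to piece [N]. *)
  have [pE|pa'] := eqVneq p.1 a.
    exists N => //; rewrite /U ltnSn; split => //; rewrite pE /st.
    rewrite [X in _ && (_ <= X)]mulrC divfK// lexx andbT.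
    by rewrite mulrA ler_pdivrMr// mulrC ler_pM2l// ler_nat.
  have x0 : 0 <= p.1 / st by rewrite divr_ge0// ltW.
  exists (Num.trunc (p.1 / st)) => //; have /andP[t1 t2] := truncn_itv x0.
  rewrite /U ifT; last first.
    rewrite -(ltr_nat R); apply: le_lt_trans t1 _.
    rewrite ltr_pdivrMr// /st mulrC divfK// lt_neqAle pa' pa//.
  split => //; rewrite -ler_pdivlMr// t1/=.
  by rewrite -ler_pdivrMr// ltW.
rewrite (nneseries_split 0 N.+1); last by move=> k _; exact: ediam_ge0.
rewrite add0n eseries0 ?adde0; last first.
  by move=> n Nn _; rewrite /U ltnNge Nn/= ediam0.
apply: (@le_trans _ _ (\sum_(0 <= k < N.+1) st%:E)%E).
  by apply: lee_sum => i _; exact: dU.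
rewrite sumEFin lee_fin sumr_const_nat subn0 -mulr_natr.
by rewrite /st divfK.
Qed.

End HausdorffLipschitz.

(** * Homotheties of the plane and the reference ellipse *)

Section Homothety.
Context {R : realType}.
Implicit Types (p q z : R * R) (A D : set (R * R)) (c r : R).

Local Notation H1 := (hausdorff1 : set (R * R) -> \bar R).
Local Notation edist := Defs.edist.

Definition homothety c r z : R * R := (c + r * z.1, c + r * z.2).

Lemma homothetyK c r : r != 0 ->
  cancel (homothety c r) (fun w => ((w.1 - c) / r, (w.2 - c) / r)).
Proof. by move=> r0 [a b]; rewrite /homothety/=; congr pair; field. Qed.

Lemma homothetyVK c r : r != 0 ->
  cancel (fun w => ((w.1 - c) / r, (w.2 - c) / r)) (homothety c r).
Proof. by move=> r0 [a b]; rewrite /homothety/=; congr pair; field. Qed.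

Lemma edist_homothety c r p q : 0 <= r ->
  edist (homothety c r p) (homothety c r q) = r * edist p q.
Proof.
move=> r0; rewrite /edist/= -[r in RHS](ger0_norm r0) -sqrtr_sqr.
by rewrite -sqrtrM ?sqr_ge0//; congr Num.sqrt; ring.
Qed.

(** The homothety is Lipschitz with constant [r] and its inverse with constant [r^-1];
    [hausdorff1_image_le] applied to each gives the two inequalities. *)
Lemma hausdorff1_homothety c r A : 0 < r ->
  (r%:E * H1 (homothety c r @^-1` A) = H1 A)%E.
Proof.
move=> r0; have rn0 : r != 0 by rewrite gt_eqF.
apply/eqP; rewrite eq_le; apply/andP; split.
  rewrite -lee_pdivlMl//.
  rewrite (_ : _ @^-1` _ = (fun w => ((w.1 - c) / r, (w.2 - c) / r)) @` A).
    apply: hausdorff1_image_le; first by rewrite invr_gt0.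
    move=> p q _ _; rewrite -[in leRHS](homothetyVK c rn0 p).
    rewrite -[in leRHS](homothetyVK c rn0 q) edist_homothety ?(ltW r0)//.
    by rewrite mulKf.
  apply/seteqP; split => [z Az|_ [w Aw <-]] /=.
    by exists (homothety c r z); rewrite // homothetyK.
  by rewrite homothetyVK.
rewrite -[in leLHS](image_preimage A (f := homothety c r)).
  apply: hausdorff1_image_le => // p q _ _.
  by rewrite edist_homothety// ltW.
apply/seteqP; split => // w _; exists ((w.1 - c) / r, (w.2 - c) / r) => //.
exact: homothetyVK.
Qed.

Lemma measurable_homothety c r : measurable_fun setT (homothety c r).
Proof.
by apply: measurable_fun_pair; apply: measurable_funD => //;
  apply: measurable_funM.
Qed.

(** By [hausdorff1_homothety], [hausdorff1] is [r] times its own pushforward under the homothety. *)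
Lemma ge0_integral_homothety c r D (f : R * R -> \bar R) : 0 < r ->
  measurable D -> measurable_fun D f -> (forall w, D w -> (0 <= f w)%E) ->
  (\int[hausdorff1]_(w in D) f w =
   \int[hausdorff1]_(z in homothety c r @^-1` D) (r%:E * f (homothety c r z)))%E.
Proof.
move=> r0 mD mf f0.
have mh := measurable_homothety c r.
have mhD : measurable (homothety c r @^-1` D).
  by rewrite -[X in measurable X]setTI; exact: mh.
pose k := NngNum (ltW r0).
rewrite (eq_measure_integral
  (mscale k (pushforward hausdorff1 (homothety c r)))); last first.
  move=> A mA _.
  by rewrite /= /mscale/= /pushforward hausdorff1_homothety.
rewrite ge0_integral_mscale// ge0_integral_pushforward//; last first.
  by move=> w /[!inE]; exact: f0.
have mfh : measurable_fun (homothety c r @^-1` D) (f \o homothety c r).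
  apply: (measurable_comp mD) => //; last exact: measurable_funS mh.
  by move=> _ [z Dz <-].
by rewrite ge0_integralZl ?lee_fin ?(ltW r0)// => z; exact: f0.
Qed.

(** This is [z.1 ^+ 2 + z.2 ^+ 2 + (z.1 + z.2) ^+ 2]: the energy of three velocities with zero sum,
    the third being [- z.1 - z.2]. *)
Definition disc (z : R * R) := 2 * z.1 ^+ 2 + 2 * z.2 ^+ 2 + 2 * (z.1 * z.2).

Definition ellipse : set (R * R) := [set z | disc z = 1].

Lemma measurable_disc : measurable_fun setT disc.
Proof.
apply: measurable_funD; first apply: measurable_funD.
- by apply: measurable_funM => //; apply: measurable_funX; exact: measurable_fst.
- by apply: measurable_funM => //; apply: measurable_funX; exact: measurable_snd.
apply: measurable_funM => //; apply: measurable_funM.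
  exact: measurable_fst.
exact: measurable_snd.
Qed.

Lemma measurable_ellipse : measurable ellipse.
Proof.
rewrite (_ : ellipse = setT `&` disc @^-1` [set 1]).
  exact: measurable_disc.
by rewrite setTI.
Qed.

Lemma cos_lip (a b : R) : `|cos a - cos b| <= `|a - b|.
Proof.
wlog ba : a b / b <= a.
  move=> h; have [|/ltW] := leP b a; first exact: h.
  by move=> /h; rewrite distrC (distrC a).
have [|c _ ->] := @MVT_segment R cos (fun x => - sin x) b a ba _ _.
- by apply: continuous_subspaceT => x; exact: continuous_cos.
- rewrite normrM normrN ler_piMl// ler_norml.
  by rewrite sin_geN1 sin_le1.
Qed.

Lemma sin_lip (a b : R) : `|sin a - sin b| <= `|a - b|.
Proof.
wlog ba : a b / b <= a.
  move=> h; have [|/ltW] := leP b a; first exact: h.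
  by move=> /h; rewrite distrC (distrC a).
have [|c _ ->] := @MVT_segment R sin cos b a ba _ _.
- by apply: continuous_subspaceT => x; exact: continuous_sin.
- rewrite normrM ler_piMl// ler_norml.
  by rewrite cos_geN1 cos_le1.
Qed.

Lemma edist_le_add p q : edist p q <= `|p.1 - q.1| + `|p.2 - q.2|.
Proof.
rewrite -[leRHS]ger0_norm ?addr_ge0// -sqrtr_sqr ler_wsqrtr//.
rewrite -(real_normK (num_real (p.1 - q.1))) -(real_normK (num_real (p.2 - q.2))).
by rewrite sqrrD lerD2r lerDl mulrn_wge0// mulr_ge0.
Qed.

(** The ellipse is covered by two Lipschitz images of the segment from 0 to [pi], one for each sign
    of the second coordinate. *)
Lemma hausdorff1_ellipse : (H1 ellipse < +oo)%E.
Proof.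
(* Completing the square, [disc (a, b)] is [2 * (a + b / 2) ^+ 2 + 3 / 2 * b ^+ 2]; [k1] and [k2]
   are the semi-axes in the coordinates [a + b / 2] and [b]. *)
pose k1 : R := Num.sqrt 2^-1; pose k2 : R := Num.sqrt (2 / 3).
have k1E : k1 ^+ 2 = 2^-1 by rewrite sqr_sqrtr.
have k2E : k2 ^+ 2 = 2 / 3 by rewrite sqr_sqrtr.
have k10 : 0 < k1 by rewrite sqrtr_gt0 invr_gt0.
have k20 : 0 < k2 by rewrite sqrtr_gt0 divr_gt0.
have k11 : k1 <= 1 by rewrite -(@ler_pXn2r _ 2) ?nnegrE ?(ltW k10)// k1E; lra.
have k21 : k2 <= 1 by rewrite -(@ler_pXn2r _ 2) ?nnegrE ?(ltW k20)// k2E; lra.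
pose S := [set p : R * R | 0 <= p.1 <= pi /\ p.2 = 0].
pose psi (s : R) p : R * R :=
  (k1 * cos p.1 - s * (k2 * sin p.1) / 2, s * (k2 * sin p.1)).
(* The first coordinate contributes at most 3/2 and the second at most 1, so 3 is a convenient upper
   bound. *)
have psi_lip s p q : `|s| = 1 -> edist (psi s p) (psi s q) <= 3 * edist p q.
  move=> s1; apply: le_trans (edist_le_add _ _) _ => /=.
  have k2s : `|s * (k2 * sin p.1) - s * (k2 * sin q.1)| <= edist p q.
    rewrite -!mulrBr !normrM s1 mul1r (gtr0_norm k20).
    apply: le_trans (edist_fst p q); apply: le_trans (sin_lip _ _).
    by rewrite ler_piMl.
  have k1s : `|k1 * cos p.1 - k1 * cos q.1| <= edist p q.
    rewrite -!mulrBr !normrM (gtr0_norm k10).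
    apply: le_trans (edist_fst p q); apply: le_trans (cos_lip _ _).
    by rewrite ler_piMl.
  move: k2s k1s; set x := s * _; set y := s * _; set u := k1 * _.
  set w := k1 * _; set d := edist p q => h1 h2.
  have : `|u - x / 2 - (w - y / 2)| <= d + d / 2.
    rewrite (_ : _ - _ = (u - w) - (x - y) / 2); last by ring.
    apply: le_trans (ler_normB _ _) _; apply: lerD => //.
    by rewrite normrM (ger0_norm (x := 2^-1)) ?invr_ge0// ler_wpM2r ?invr_ge0.
  have : 0 <= d by rewrite sqrtr_ge0.
  by lra.
have cover : ellipse `<=` psi 1 @` S `|` psi (-1) @` S.
  move=> [a b]; rewrite /ellipse /disc /= => q1.
  pose X := (a + b / 2) / k1; pose Y := b / k2.
  have XY : X ^+ 2 + Y ^+ 2 = 1.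
    by apply: etrans q1; rewrite /X /Y !expr_div_n k1E k2E; field.
  have X1 : -1 <= X <= 1.
    rewrite -ler_norml -(@ler_pXn2r _ 2) ?nnegrE// expr1n.
    by rewrite real_normK ?num_real// -XY lerDl sqr_ge0.
  have bE : b = k2 * Y by rewrite /Y mulrC divfK// gt_eqF.
  have aE : a = k1 * X - b / 2 by rewrite /X [k1 * _]mulrC divfK ?gt_eqF//; ring.
  have sX : sin (acos X) = `|Y|.
    by rewrite sin_acos// -XY addrAC subrr add0r sqrtr_sqr.
  have SX : S (acos X, 0) by split; rewrite //= acos_ge0// acos_lepi.
  have cX : cos (acos X) = X by rewrite acosK// in_itv.
  have [Y0|Y0] := leP 0 Y; [left|right]; exists (acos X, 0) => //.
    by rewrite /psi/= sX cX mul1r ger0_norm// -bE -aE.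
  by rewrite /psi/= sX cX ltr0_norm// mulN1r mulrN opprK -bE -aE.
apply: (@le_lt_trans _ _ ((3 * pi)%:E + (3 * pi)%:E)%E); last first.
  by rewrite -EFinD ltry.
apply: le_trans (le_hausdorff1 cover) _.
apply: le_trans (outer_measureU2 _ _ _) _.
have HS s : `|s| = 1 -> (H1 (psi s @` S) <= (3 * pi)%:E)%E.
  move=> s1; apply: (@le_trans _ _ (3%:E * H1 S)%E).
    by apply: hausdorff1_image_le => // p q _ _; exact: psi_lip.
  by rewrite EFinM lee_wpmul2l ?lee_fin// hausdorff1_segment_le// pi_gt0.
by apply: leeD; apply: HS; rewrite ?normrN normr1.
Qed.

End Homothety.

(** * The resonant curve *)

Section ResonanceCurve.
Context {R : realType}.
Implicit Types (u w z : R * R) (v r x : R).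

Local Notation H1 := (hausdorff1 : set (R * R) -> \bar R).

(* [resonance v u.1 u.2 = 0] is the circle of radius [sqrt (excess v u)] for the
   quadratic form [disc], centred at the point with both coordinates equal to
   the mean velocity. *)
Definition mean v u := (v + u.1 + u.2) / 3.

(** The energy of [v], [u.1], [u.2] relative to their mean. *)
Definition excess v u := v ^+ 2 + u.1 ^+ 2 + u.2 ^+ 2 - (v + u.1 + u.2) ^+ 2 / 3.

Definition outgoing v u z : R * R := homothety (mean v u) (Num.sqrt (excess v u)) z.

(** The Euclidean norm of the gradient of [disc]. *)
Definition disc_grad z :=
  2 * Num.sqrt ((2 * z.1 + z.2) ^+ 2 + (z.1 + 2 * z.2) ^+ 2).

Lemma mulr_sqrt r x : 0 <= r -> r * Num.sqrt x = Num.sqrt (r ^+ 2 * x).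
Proof. by move=> r0; rewrite sqrtrM ?sqr_ge0// sqrtr_sqr ger0_norm. Qed.

Lemma excess_ge0 v u : 0 <= excess v u.
Proof.
rewrite /excess (_ : _ - _ =
  ((v - u.1) ^+ 2 + (v - u.2) ^+ 2 + (u.1 - u.2) ^+ 2) / 3); last by field.
by rewrite divr_ge0// !addr_ge0// sqr_ge0.
Qed.

(** Relative to [mean v u] the three outgoing velocities sum to zero, so the linear terms cancel and
    only the quadratic form survives. *)
Lemma resonance_homothety v u r z :
  resonance v u.1 u.2 (homothety (mean v u) r z) = excess v u - r ^+ 2 * disc z.
Proof. by rewrite /resonance /Omega /v5_of /homothety /excess /mean /disc/=; field. Qed.

Lemma resonance_outgoing v u z : disc z = 1 ->
  resonance v u.1 u.2 (outgoing v u z) = 0.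
Proof.
by move=> z1; rewrite resonance_homothety z1 sqr_sqrtr ?excess_ge0// mulr1 subrr.
Qed.

Lemma derive1_quadratic (a b c x : R) :
  derive1 (fun y => a + b * y + c * y ^+ 2) x = b + 2 * c * x.
Proof.
rewrite derive1E.
have -> : (fun y => a + b * y + c * y ^+ 2) =
  (cst a + (cst b * (@id R)) + (cst c * (@id R) ^+ 2))%R.
  by apply/funext => y; rewrite /= !fctE.
rewrite derive_val /= /GRing.scale/=; ring.
Qed.

Lemma gradient_norm_resonance v u w : gradient_norm (resonance v u.1 u.2) w =
  2 * Num.sqrt ((v + u.1 + u.2 - 2 * w.1 - w.2) ^+ 2 +
                (v + u.1 + u.2 - w.1 - 2 * w.2) ^+ 2).
Proof.
rewrite /gradient_norm.
have -> : (fun x => resonance v u.1 u.2 (x, w.2)) = (fun x =>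
   (resonance v u.1 u.2 (0, w.2)) + 2 * (v + u.1 + u.2 - w.2) * x + (- 2) * x ^+ 2).
  by apply/funext => x; rewrite /resonance /Omega /v5_of/=; ring.
have -> : (fun x => resonance v u.1 u.2 (w.1, x)) = (fun x =>
   (resonance v u.1 u.2 (w.1, 0)) + 2 * (v + u.1 + u.2 - w.1) * x + (- 2) * x ^+ 2).
  by apply/funext => x; rewrite /resonance /Omega /v5_of/=; ring.
by rewrite !derive1_quadratic mulr_sqrt//; congr Num.sqrt; ring.
Qed.

Lemma gradient_norm_homothety v u r z : 0 <= r ->
  gradient_norm (resonance v u.1 u.2) (homothety (mean v u) r z) = r * disc_grad z.
Proof.
move=> r0; rewrite gradient_norm_resonance /disc_grad mulrCA; congr (2 * _).
rewrite mulr_sqrt//; congr Num.sqrt.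
by rewrite /homothety /mean/=; field.
Qed.

(** With [z = (a, b)], [disc_grad z ^+ 2 - disc z] equals [15 * (a + b) ^+ 2 + 3 * a ^+ 2 + 3 * b ^+
    2]. Dividing by the gradient therefore never enlarges the collision integrand. *)
Lemma disc_grad_ge1 z : disc z = 1 -> 1 <= disc_grad z.
Proof.
rewrite /disc /disc_grad => z1.
rewrite -[leLHS]sqrtr1 mulr_sqrt//.
apply: ler_wsqrtr; set a := z.1; set b := z.2.
have : 0 <= (a + b) ^+ 2 by exact: sqr_ge0.
have : 0 <= a ^+ 2 by exact: sqr_ge0.
have : 0 <= b ^+ 2 by exact: sqr_ge0.
by move: z1; rewrite -/a -/b !expr2; lra.
Qed.

Lemma measurable_disc_grad : measurable_fun setT disc_grad.
Proof.
have m1 : measurable_fun setT (fun z : R * R => z.1) by exact: measurable_fst.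
have m2 : measurable_fun setT (fun z : R * R => z.2) by exact: measurable_snd.
apply: measurable_funM => //; apply: measurableT_comp.
  exact: (continuous_measurable_fun (@sqrt_continuous R)).
by apply: measurable_funD; apply: measurable_funX; apply: measurable_funD => //;
  apply: measurable_funM.
Qed.

Lemma measurable_gradient_norm_resonance v u :
  measurable_fun setT (gradient_norm (resonance v u.1 u.2)).
Proof.
have m1 : measurable_fun setT (fun z : R * R => z.1) by exact: measurable_fst.
have m2 : measurable_fun setT (fun z : R * R => z.2) by exact: measurable_snd.
rewrite (funext (gradient_norm_resonance v u)).
apply: measurable_funM => //; apply: measurableT_comp.
  exact: (continuous_measurable_fun (@sqrt_continuous R)).
by apply: measurable_funD; apply: measurable_funX; apply: measurable_funB => //;
  repeat apply: measurable_funB => //; apply: measurable_funM.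
Qed.

Lemma measurable_resonance v u : measurable_fun setT (resonance v u.1 u.2).
Proof.
have m1 : measurable_fun setT (fun z : R * R => z.1) by exact: measurable_fst.
have m2 : measurable_fun setT (fun z : R * R => z.2) by exact: measurable_snd.
by repeat (apply: measurable_funB => //); apply: measurable_funX => //;
  repeat (apply: measurable_funB => //).
Qed.

(** On nonnegative reals the inverse is the power of exponent -1, also at 0, where both take the
    value 0. *)
Lemma measurable_funV_ge0 d (T : measurableType d) (g : T -> R) :
  (forall y, 0 <= g y) -> measurable_fun setT g ->
  measurable_fun setT (fun y => (g y)^-1).
Proof.
move=> g0 mg; under eq_fun do rewrite -powR_inv1//.
exact: measurableT_comp (measurable_powR _) mg.
Qed.

(** Arc length and gradient both scale by the square root of [excess v u], so the ratio cancels and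
    only the argument of [F] still depends on [v] and [u]. The indicator covers the case where the
    curve shrinks to a point. *)
Lemma delta_integral_resonance v u (F : R * R -> R) : measurable_fun setT F ->
  delta_integral (resonance v u.1 u.2) F =
  \int[@hausdorff1 R]_(z in ellipse)
    ((0 < excess v u)%R%:R * (F (outgoing v u z) / disc_grad z)).
Proof.
move=> mF; have := excess_ge0 v u; rewrite le_eqVlt => /predU1P[e0|e0]; last first.
  rewrite e0; under [in RHS]eq_Rintegral do rewrite mul1r.
  set r := Num.sqrt (excess v u); have r0 : 0 < r by rewrite sqrtr_gt0.
  pose D : set (R * R) := [set w | resonance v u.1 u.2 w = 0].
  have mD : measurable D.
    rewrite -[D]setTI.
    exact: (measurable_resonance v u measurableT (measurable_set1 0)).
  have DE : homothety (mean v u) r @^-1` D = ellipse.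
    apply/seteqP; split => z; rewrite /D /ellipse /= resonance_homothety;
      rewrite sqr_sqrtr ?excess_ge0//; last by move=> ->; rewrite mulr1 subrr.
    move/eqP; rewrite subr_eq0 -{1}[excess _ _]mulr1 => /eqP/mulfI ->//.
    by rewrite gt_eqF.
  set g := fun w => F w / gradient_norm (resonance v u.1 u.2) w.
  have mg : measurable_fun D (EFin \o g).
    apply/measurable_EFinP; apply: measurable_funTS; apply: measurable_funM => //.
    apply: measurable_funV_ge0; last exact: measurable_gradient_norm_resonance.
    by move=> w; rewrite sqrtr_ge0.
  have gE z : r * g (homothety (mean v u) r z) = F (outgoing v u z) / disc_grad z.
    rewrite /g gradient_norm_homothety ?(ltW r0)// /outgoing -/r.
    by rewrite invfM mulrCA (mulrA r) mulfV ?gt_eqF// mul1r.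
  rewrite /delta_integral /Rintegral -/D; congr fine.
  under [in RHS]eq_integral do rewrite -gE EFinM.
  (* The change of variables is proved for nonnegative functions, hence the split into positive and
     negative parts. *)
  rewrite integralE [in RHS]integralE ge0_funeposM ?(ltW r0)//.
  rewrite ge0_funenegM ?(ltW r0)//; congr (_ - _)%E.
    rewrite (ge0_integral_homothety (mean v u) r0) ?DE//.
      by apply: eq_integral => z _; rewrite !funeposE.
    exact: measurable_funepos.
  rewrite (ge0_integral_homothety (mean v u) r0) ?DE//.
    by apply: eq_integral => z _; rewrite !funenegE.
  exact: measurable_funeneg.
(* With zero excess, the only resonant point has both coordinates equal to the mean. The gradient
   vanishes there and division by zero yields 0, so both sides are 0. *)
rewrite -e0 ltxx /delta_integral /Rintegral [in RHS]integral0_eq; last first.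
  by move=> z _; rewrite mul0r.
rewrite integral0_eq// => w /= h0; rewrite gradient_norm_resonance.
suff [-> ->] : w.1 = mean v u /\ w.2 = mean v u.
  rewrite (_ : (_ - _) = 0); last by rewrite /mean; field.
  rewrite (_ : (_ - _ - 2 * _) = 0); last by rewrite /mean; field.
  by rewrite expr0n/= addr0 sqrtr0 mulr0 invr0 mulr0.
(* Ratio 1 writes [w] as the mean plus its deviation; the quadratic form of that deviation is then
   0. *)
have := resonance_homothety v u 1 (w.1 - mean v u, w.2 - mean v u).
rewrite /homothety/= !mul1r !(addrC (mean v u)) !subrK -surjective_pairing h0 -e0.
rewrite add0r expr1n mul1r => /esym/eqP; rewrite oppr_eq0 /disc/=.
set a := w.1 - _; set b := w.2 - _.
rewrite (_ : _ + _ = a ^+ 2 + b ^+ 2 + (a + b) ^+ 2); last by ring.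
rewrite !paddr_eq0 ?addr_ge0 ?sqr_ge0// !sqrf_eq0 => /andP[/andP[]].
by rewrite !subr_eq0 => /eqP -> /eqP ->.
Qed.

End ResonanceCurve.

(** * Measurability of integrals depending on a parameter *)

(* Nonnegative Tonelli measurability is a hypothesis, so that the lemma also
   applies to product measures, for which the library infers no
   [sigma_finite_measure] structure. *)
Lemma measurable_Rintegral_ge0_param d d' (X : measurableType d)
    (Y : measurableType d') (R : realType) (m : {measure set Y -> \bar R})
    (k : X -> Y -> R) :
  (forall h : X * Y -> \bar R, measurable_fun setT h -> (forall q, 0 <= h q)%E ->
    measurable_fun setT (fun x => \int[m]_y h (x, y))%E) ->
  measurable_fun setT (fun q : X * Y => k q.1 q.2) ->
  measurable_fun setT (fun x => \int[m]_y k x y).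
Proof.
move=> mint mk; have mk' : measurable_fun setT (fun q : X * Y => (k q.1 q.2)%:E).
  exact/measurable_EFinP.
apply: measurableT_comp; first exact: fine_measurable.
under eq_fun do rewrite integralE; apply: emeasurable_funB.
- apply: (mint (fun q => (fun y => (k q.1 y)%:E)^\+%E q.2)) => [|q];
    last exact: funepos_ge0.
  rewrite [X in measurable_fun _ X](_ : _ = (fun q => (k q.1 q.2)%:E)^\+%E).
    exact: measurable_funepos.
  by apply/funext => q; rewrite !funeposE.
- apply: (mint (fun q => (fun y => (k q.1 y)%:E)^\-%E q.2)) => [|q];
    last exact: funeneg_ge0.
  rewrite [X in measurable_fun _ X](_ : _ = (fun q => (k q.1 q.2)%:E)^\-%E).
    exact: measurable_funeneg.
  by apply/funext => q; rewrite !funenegE.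
Qed.

Section ParametricIntegral.
Context d d' (X : measurableType d) (Y : measurableType d') (R : realType).

Lemma measurable_Rintegral_param (m : {sigma_finite_measure set Y -> \bar R})
    (k : X -> Y -> R) :
  measurable_fun setT (fun q : X * Y => k q.1 q.2) ->
  measurable_fun setT (fun x => \int[m]_y k x y).
Proof.
apply: measurable_Rintegral_ge0_param => h mh h0.
exact: measurable_fun_fubini_tonelli_F.
Qed.

(** The double integral is rewritten as an iterated one, and Tonelli measurability is applied once
    per variable. *)
Lemma measurable_Rintegral_prod_param d2 (Y' : measurableType d2)
    (m : {sigma_finite_measure set Y -> \bar R})
    (m' : {sigma_finite_measure set Y' -> \bar R}) (k : X -> Y * Y' -> R) :
  measurable_fun setT (fun q : X * (Y * Y') => k q.1 q.2) ->
  measurable_fun setT (fun x => \int[(m \x m')%E]_u k x u).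
Proof.
apply: measurable_Rintegral_ge0_param => h mh h0.
have mhx x : measurable_fun setT (fun u => h (x, u)).
  exact: measurableT_comp mh (pair1_measurable x).
under eq_fun => x do rewrite (fubini_tonelli1 (fun u => h (x, u)))//.
apply: (measurable_fun_fubini_tonelli_F
  (fun q : X * Y => fubini_F m' (fun u => h (q.1, u)) q.2)).
  apply: (measurable_fun_fubini_tonelli_F
    (fun q : (X * Y) * Y' => h (q.1.1, (q.1.2, q.2)))) => //.
  apply: measurableT_comp mh _.
  have m1 : measurable_fun setT (fun q : X * Y * Y' => q.1) by exact: measurable_fst.
  apply: measurable_fun_pair; first exact: measurableT_comp measurable_fst m1.
  apply: measurable_fun_pair; last exact: measurable_snd.
  exact: measurableT_comp measurable_snd m1.
by move=> q; apply: integral_ge0.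
Qed.

(** Meant for [hausdorff1], which is not sigma-finite on the plane: its restriction to a set of
    finite measure is a finite measure, to which the sigma-finite case applies. *)
Lemma measurable_Rintegral_restr_param (m : {measure set Y -> \bar R}) (D : set Y)
    (k : X -> Y -> R) : measurable D -> (m D < +oo)%E ->
  measurable_fun setT (fun q : X * Y => k q.1 q.2) ->
  measurable_fun setT (fun x => \int[m]_(y in D) k x y).
Proof.
move=> mD mDoo mk.
rewrite [X in measurable_fun _ X](_ : _ = fun x =>
    \int[mfrestr mD mDoo]_y (k x y * \1_D y)).
  apply: measurable_Rintegral_param; apply: measurable_funM => //.
  by apply: measurableT_comp => //; exact: measurable_indic.
apply/funext => x; rewrite /Rintegral; congr fine.
rewrite (eq_measure_integral (mfrestr mD mDoo)); last first.
  by move=> A mA AD; rewrite /= /mfrestr /mrestr setIidl.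
rewrite integral_mkcond; apply: eq_integral => y _.
by rewrite patchE indicE; case: ifPn; rewrite ?mulr1 ?mulr0.
Qed.

End ParametricIntegral.

(** * Measurability of the collision operator *)

Section Collision.
Context {R : realType}.
Implicit Types (f : R -> R -> R -> R) (u z : R * R) (t x v : R).

Definition collision_kernel f t x v u z : R :=
  let w := outgoing v u z in
  (0 < excess v u)%R%:R * (C6_integrand (f t x v) (f t x u.1) (f t x u.2)
     (f t x w.1) (f t x w.2) (f t x (v5_of v u.1 u.2 w.1 w.2)) / disc_grad z).

Lemma measurable_comp3 d (T : measurableType d) f (a b c : T -> R) :
  jointly_measurable f -> measurable_fun setT a -> measurable_fun setT b ->
  measurable_fun setT c -> measurable_fun setT (fun q => f (a q) (b q) (c q)).
Proof.
move=> mf ma mb mc.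
apply: (measurableT_comp mf (g := fun q => (a q, b q, c q))).
by apply: measurable_fun_pair => //; exact: measurable_fun_pair.
Qed.

Lemma measurable_C6_integrand d (T : measurableType d) (a b c a' b' c' : T -> R) :
  measurable_fun setT a -> measurable_fun setT b -> measurable_fun setT c ->
  measurable_fun setT a' -> measurable_fun setT b' -> measurable_fun setT c' ->
  measurable_fun setT (fun q => C6_integrand (a q) (b q) (c q) (a' q) (b' q) (c' q)).
Proof.
move=> ma mb mc ma' mb' mc'.
by repeat first [exact: ma | exact: mb | exact: mc | exact: ma' | exact: mb' |
  exact: mc' | apply: measurable_funB | apply: measurable_funD |
  apply: measurable_funM].
Qed.

Lemma measurable_v5_of d (T : measurableType d) (a b c a' b' : T -> R) :
  measurable_fun setT a -> measurable_fun setT b -> measurable_fun setT c ->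
  measurable_fun setT a' -> measurable_fun setT b' ->
  measurable_fun setT (fun q => v5_of (a q) (b q) (c q) (a' q) (b' q)).
Proof.
move=> ma mb mc ma' mb'.
by repeat first [exact: ma | exact: mb | exact: mc | exact: ma' | exact: mb' |
  apply: measurable_funB | apply: measurable_funD].
Qed.

(** In this form the domain of integration is fixed, and [t], [x], [v], [u] enter through the
    integrand only. *)
Lemma C6E f t x v : jointly_measurable f ->
  C6 f t x v = \int[(lebesgue_measure \x lebesgue_measure)%E]_u
    \int[@hausdorff1 R]_(z in @ellipse R) collision_kernel f t x v u z.
Proof.
move=> mf; rewrite /C6; apply: eq_Rintegral => u _.
rewrite delta_integral_resonance//.
have mw1 : measurable_fun setT (fun w : R * R => w.1) by exact: measurable_fst.
have mw2 : measurable_fun setT (fun w : R * R => w.2) by exact: measurable_snd.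
by apply: measurable_C6_integrand => //; apply: measurable_comp3 => //;
  apply: measurable_v5_of.
Qed.

Lemma measurable_excess : measurable_fun setT (fun q : R * (R * R) => excess q.1 q.2).
Proof.
have m0 : measurable_fun setT (fun q : R * (R * R) => q.1) by exact: measurable_fst.
have m2 : measurable_fun setT (fun q : R * (R * R) => q.2) by exact: measurable_snd.
have m3 := measurableT_comp measurable_fst m2.
have m4 := measurableT_comp measurable_snd m2.
by apply: measurable_funB; [repeat apply: measurable_funD|apply: measurable_funM];
  rewrite //; apply: measurable_funX => //; repeat apply: measurable_funD.
Qed.

Lemma measurable_collision_kernel f : jointly_measurable f ->
  measurable_fun setT (fun q : (R * R * R) * (R * R) * (R * R) =>
    collision_kernel f q.1.1.1.1 q.1.1.1.2 q.1.1.2 q.1.2 q.2).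
Proof.
move=> mf.
pose T := ((R * R * R) * (R * R) * (R * R))%type.
have m1 : measurable_fun setT (fun q : T => q.1) by exact: measurable_fst.
have m11 : measurable_fun setT (fun q : T => q.1.1).
  exact: measurableT_comp measurable_fst m1.
have m12 : measurable_fun setT (fun q : T => q.1.2).
  exact: measurableT_comp measurable_snd m1.
have m2 : measurable_fun setT (fun q : T => q.2) by exact: measurable_snd.
have mt : measurable_fun setT (fun q : T => q.1.1.1.1).
  exact: measurableT_comp measurable_fst (measurableT_comp measurable_fst m11).
have mx : measurable_fun setT (fun q : T => q.1.1.1.2).
  exact: measurableT_comp measurable_snd (measurableT_comp measurable_fst m11).
have mv : measurable_fun setT (fun q : T => q.1.1.2).
  exact: measurableT_comp measurable_snd m11.
have mu1 : measurable_fun setT (fun q : T => q.1.2.1).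
  exact: measurableT_comp measurable_fst m12.
have mu2 : measurable_fun setT (fun q : T => q.1.2.2).
  exact: measurableT_comp measurable_snd m12.
have mz1 : measurable_fun setT (fun q : T => q.2.1).
  exact: measurableT_comp measurable_fst m2.
have mz2 : measurable_fun setT (fun q : T => q.2.2).
  exact: measurableT_comp measurable_snd m2.
have mex : measurable_fun setT (fun q : T => excess q.1.1.2 q.1.2).
  exact: (measurableT_comp measurable_excess (measurable_fun_pair mv m12)).
have msq : measurable_fun setT (fun q : T => Num.sqrt (excess q.1.1.2 q.1.2)).
  exact: measurableT_comp (continuous_measurable_fun (@sqrt_continuous R)) mex.
have mmn : measurable_fun setT (fun q : T => mean q.1.1.2 q.1.2).
  by apply: measurable_funM => //; repeat apply: measurable_funD.
have mw1 : measurable_fun setT (fun q : T => (outgoing q.1.1.2 q.1.2 q.2).1).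
  by apply: measurable_funD => //; apply: measurable_funM.
have mw2 : measurable_fun setT (fun q : T => (outgoing q.1.1.2 q.1.2 q.2).2).
  by apply: measurable_funD => //; apply: measurable_funM.
apply: measurable_funM; last apply: measurable_funM.
- rewrite [X in measurable_fun _ X](_ : _ = fun q : T =>
    if (0 < excess q.1.1.2 q.1.2)%R then 1 else 0 : R).
    by apply: measurable_fun_ifT => //; exact: measurable_fun_ltr.
  by apply/funext => q; case: ifP.
- by apply: measurable_C6_integrand; apply: measurable_comp3 => //;
    apply: measurable_v5_of.
- apply: (measurable_funV_ge0 (g := fun q : T => disc_grad q.2)).
    by move=> q; rewrite mulr_ge0// sqrtr_ge0.
  exact: measurableT_comp measurable_disc_grad m2.
Qed.

Lemma jointly_measurable_C6 f : jointly_measurable f -> jointly_measurable (C6 f).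
Proof.
move=> mf; rewrite /jointly_measurable.
under eq_fun do rewrite C6E//.
apply: (@measurable_Rintegral_prod_param _ _ (R * R * R)%type _ _ _ _
  (@lebesgue_measure R) (@lebesgue_measure R) (fun q u =>
  \int[@hausdorff1 R]_(z in @ellipse R) collision_kernel f q.1.1 q.1.2 q.2 u z)).
apply: (@measurable_Rintegral_restr_param _ _ ((R * R * R) * (R * R))%type _ _ _ _
  (fun q z => collision_kernel f q.1.1.1 q.1.1.2 q.1.2 q.2 z)).
- exact: measurable_ellipse.
- exact: hausdorff1_ellipse.
- exact: measurable_collision_kernel.
Qed.

End Collision.

(** * Pointwise collision estimates *)

Section Close.
Context {R : realDomainType}.
Implicit Types (P E w a b : R).

(** Sizes and difference are tracked together, relative to a weight [w], because the product rule
    for differences needs both. *)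
Definition close P E w a b := [/\ `|a| <= P * w, `|b| <= P * w & `|a - b| <= E * w].

Lemma closeM P E w a b P' E' w' a' b' :
  close P E w a b -> close P' E' w' a' b' ->
  close (P * P') (E * P' + P * E') (w * w') (a * a') (b * b').
Proof.
move=> [a1 b1 ab1] [a2 b2 ab2]; split.
- by rewrite normrM mulrACA ler_pM.
- by rewrite normrM mulrACA ler_pM.
- rewrite (_ : _ - _ = (a - b) * a' + b * (a' - b')); last by ring.
  rewrite [leRHS]mulrDl; apply: le_trans (ler_normD _ _) _.
  by rewrite !normrM (mulrACA E) (mulrACA P) lerD// ler_pM.
Qed.

Lemma closeD P E w a b P' E' a' b' :
  close P E w a b -> close P' E' w a' b' ->
  close (P + P') (E + E') w (a + a') (b + b').
Proof.
move=> [a1 b1 ab1] [a2 b2 ab2]; split; rewrite mulrDl.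
- by apply: le_trans (ler_normD _ _) _; exact: lerD.
- by apply: le_trans (ler_normD _ _) _; exact: lerD.
- rewrite opprD addrACA; apply: le_trans (ler_normD _ _) _; exact: lerD.
Qed.

Lemma closeN P E w a b : close P E w a b -> close P E w (- a) (- b).
Proof. by move=> [a1 b1 ab1]; split; rewrite ?normrN// -opprD normrN. Qed.

Lemma close_le P E w w' a b : 0 <= P -> 0 <= E -> w <= w' ->
  close P E w a b -> close P E w' a b.
Proof.
move=> P0 E0 ww' [a1 b1 ab1].
by split; [apply: le_trans a1 _|apply: le_trans b1 _|apply: le_trans ab1 _];
  rewrite ler_wpM2l.
Qed.

End Close.

(** * Gaussian weights and the Lipschitz estimate for the collision operator *)

Section CollisionEstimate.
Context {R : realType}.
Implicit Types (f g : R -> R -> R -> R) (u z : R * R) (t x v M D : R).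

(** Each of the 6 quintic monomials contains the full triple 0, 1, 2 or the full triple 3, 4, 5,
    whose weights have the same product by [cons]. The other two weights are bounded by 1. The
    product rule gives 5 terms per monomial, hence 30. *)
Lemma close_C6_integrand M D a0 a1 a2 a3 a4 a5 b0 b1 b2 b3 b4 b5
    w0 w1 w2 w3 w4 w5 : 0 <= M -> 0 <= D ->
  close M D w0 a0 b0 -> close M D w1 a1 b1 -> close M D w2 a2 b2 ->
  close M D w3 a3 b3 -> close M D w4 a4 b4 -> close M D w5 a5 b5 ->
  0 <= w0 <= 1 -> 0 <= w1 <= 1 -> 0 <= w2 <= 1 ->
  0 <= w3 <= 1 -> 0 <= w4 <= 1 -> 0 <= w5 <= 1 ->
  w0 * w1 * w2 = w3 * w4 * w5 ->
  close (6 * M ^+ 5) (30 * M ^+ 4 * D) (w0 * w1 * w2)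
    (C6_integrand a0 a1 a2 a3 a4 a5) (C6_integrand b0 b1 b2 b3 b4 b5).
Proof.
move=> M0 D0 c0 c1 c2 c3 c4 c5 w0b w1b w2b w3b w4b w5b cons.
(* The quadratic factors give up their weights. *)
have pair w w' a a' b b' : 0 <= w <= 1 -> 0 <= w' <= 1 ->
    close M D w a b -> close M D w' a' b' ->
    close (M * M) (D * M + M * D) 1 (a * a') (b * b').
  move=> /andP[? ?] /andP[? ?] h h'; apply: close_le (closeM h h').
  - exact: mulr_ge0.
  - by rewrite addr_ge0 ?mulr_ge0.
  - exact: mulr_ile1.
have gain := closeM (closeM (closeM c3 c4) c5)
  (closeD (closeD (pair _ _ _ _ _ _ w0b w1b c0 c1) (pair _ _ _ _ _ _ w0b w2b c0 c2))
          (pair _ _ _ _ _ _ w1b w2b c1 c2)).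
have loss := closeM (closeM (closeM c0 c1) c2)
  (closeD (closeD (pair _ _ _ _ _ _ w3b w4b c3 c4) (pair _ _ _ _ _ _ w3b w5b c3 c5))
          (pair _ _ _ _ _ _ w4b w5b c4 c5)).
rewrite mulr1 -cons in gain; rewrite mulr1 in loss.
rewrite /C6_integrand.
have [h1 h2 h3] := closeD gain (closeN loss).
by split; [apply: le_trans h1 _|apply: le_trans h2 _|apply: le_trans h3 _];
  rewrite le_eqVlt; apply/orP; left; apply/eqP; ring.
Qed.

(** The reciprocal of [weight] at the foot [x - t * v] of the free trajectory. Norm bounds on
    transported functions become pointwise bounds by multiples of [gauss]. *)
Definition gauss (al be t x v : R) : R :=
  expR (- (al * (x - t * v) ^+ 2 + be * v ^+ 2)).

Context (al be : R) (al0 : 0 < al) (be0 : 0 < be).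

Local Notation W := (gauss al be).

Lemma gauss_ge0 t x v : 0 <= W t x v. Proof. exact: expR_ge0. Qed.

Lemma gauss_le1 t x v : W t x v <= 1.
Proof.
by rewrite -expR0 ler_expR oppr_le0 addr_ge0// mulr_ge0 ?sqr_ge0 ?(ltW al0) ?(ltW be0).
Qed.

(** The total exponent of three velocities depends only on their sum and on the sum of their
    squares, which collisions conserve. *)
Lemma gauss_collision t x v u z : disc z = 1 ->
  let w := outgoing v u z in
  W t x v * W t x u.1 * W t x u.2 =
  W t x w.1 * W t x w.2 * W t x (v5_of v u.1 u.2 w.1 w.2).
Proof.
move=> z1 w; have := resonance_outgoing v u z1; rewrite -/w /resonance /Omega /v5_of.
move=> /eqP; set w5 := v + u.1 + u.2 - w.1 - w.2.
rewrite !subr_eq add0r => /eqP h.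
rewrite -!expRD; congr expR.
rewrite [LHS](_ : _ = - (al * (3 * x ^+ 2 - 2 * x * t * (v + u.1 + u.2)) +
  (al * t ^+ 2 + be) * (v ^+ 2 + u.1 ^+ 2 + u.2 ^+ 2))); last by ring.
by rewrite h /w5; ring.
Qed.

Lemma collision_kernel_close f g M D t x v u z : 0 <= M -> 0 <= D ->
  (forall y, close M D (W t x y) (f t x y) (g t x y)) -> disc z = 1 ->
  close (6 * M ^+ 5) (30 * M ^+ 4 * D) (W t x v * W t x u.1 * W t x u.2)
    (collision_kernel f t x v u z) (collision_kernel g t x v u z).
Proof.
move=> M0 D0 fg z1; rewrite /collision_kernel /=; set w := outgoing v u z.
have W01 y : 0 <= W t x y <= 1 by rewrite gauss_ge0 gauss_le1.
have [h1 h2 h3] := close_C6_integrand M0 D0 (fg v) (fg u.1) (fg u.2) (fg w.1)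
  (fg w.2) (fg (v5_of v u.1 u.2 w.1 w.2)) (W01 _) (W01 _) (W01 _) (W01 _)
  (W01 _) (W01 _) (gauss_collision t x v u z1).
have d1 := disc_grad_ge1 z1.
(* The factors added by the kernel, an indicator and the inverse of [disc_grad z], have absolute
   value at most 1. *)
have shrink c : `|(0 < excess v u)%R%:R * (c / disc_grad z)| <= `|c|.
  rewrite !normrM -[leRHS]mul1r ler_pM ?mulr_ge0//.
    by case: (0 < _)%R; rewrite ?normr1 ?normr0.
  rewrite ler_piMr// normfV invf_le1 ?normr_gt0 ?gt_eqF ?(lt_le_trans ltr01)//.
  by rewrite (le_trans d1)// ler_norm.
split; [apply: le_trans h1|apply: le_trans h2|
  rewrite -mulrBr -mulrBl; apply: le_trans h3]; exact: shrink.
Qed.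

Lemma measurable_gauss t x : measurable_fun setT (W t x).
Proof.
apply: measurableT_comp; first exact: measurable_expR.
apply: measurableT_comp => //; apply: measurable_funD; apply: measurable_funM => //.
by apply: measurable_funX; apply: measurable_funB => //; exact: measurable_funM.
Qed.

Lemma measurable_EgaussE t x :
  measurable_fun setT (fun v => (W t x v)%:E).
Proof. by apply/measurable_EFinP; exact: measurable_gauss. Qed.

(** Completing the square in [v] gives [k * (v - c) ^+ 2 + al * be * x ^+ 2 / k]. The last term is
    nonnegative and is dropped, leaving a multiple of a normal density. *)
Lemma integral_gauss_le t x :
  (\int[lebesgue_measure]_v (W t x v)%:E <=
   (Num.sqrt (pi / (be + al * t ^+ 2)))%:E)%E.
Proof.
set k := be + al * t ^+ 2; have k0 : 0 < k.
  by rewrite ltr_wpDr// mulr_ge0 ?sqr_ge0 ?ltW.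
have kn0 : k != 0 by rewrite gt_eqF.
(* Mean and standard deviation of the comparison density; [s] is chosen so that [2 * s ^+ 2] is the
   inverse of [k]. *)
pose c := al * t * x / k; pose s := Num.sqrt (2 * k)^-1.
have s2 : s ^+ 2 = (2 * k)^-1 by rewrite sqr_sqrtr// invr_ge0 mulr_ge0// ltW.
have s0 : 0 < s by rewrite sqrtr_gt0 invr_gt0 mulr_gt0.
have pk0 : 0 < pi / k by rewrite divr_gt0// pi_gt0.
have peakE : normal_peak s = (Num.sqrt (pi / k))^-1.
  rewrite /normal_peak s2 (_ : _ *+ 2 = pi / k)//.
  by rewrite -mulr_natr; field.
have W_le v : W t x v <= Num.sqrt (pi / k) * normal_pdf c s v.
  rewrite normal_pdfE ?gt_eqF// peakE mulVKf ?gt_eqF ?sqrtr_gt0//.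
  rewrite ler_expR s2.
  rewrite (_ : - (v - c) ^+ 2 / _ = - (k * (v - c) ^+ 2)); last first.
    by rewrite -mulr_natr; field.
  rewrite lerN2 -subr_ge0 (_ : _ - _ = al * be * x ^+ 2 / k).
    apply: divr_ge0; last exact: ltW.
    by apply: mulr_ge0 (sqr_ge0 _); apply: mulr_ge0; exact: ltW.
  by rewrite /c /k; field.
apply: (@le_trans _ _ (\int[lebesgue_measure]_v
    ((Num.sqrt (pi / k))%:E * (normal_pdf c s v)%:E))%E).
  apply: ge0_le_integral => //.
  - by move=> v _; rewrite lee_fin gauss_ge0.
  - exact: measurable_EgaussE.
  - apply/measurable_EFinP; apply: measurable_funM => //.
    exact: measurable_normal_pdf.
  - by move=> v _; rewrite -EFinM lee_fin.
rewrite ge0_integralZl ?lee_fin ?sqrtr_ge0//.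
- by rewrite integral_normal_pdf mule1.
- by apply/measurable_EFinP; exact: measurable_normal_pdf.
- by move=> v _; rewrite lee_fin normal_pdf_ge0.
Qed.

Definition gauss2 t x u := W t x u.1 * W t x u.2.

Lemma measurable_gauss2 t x : measurable_fun setT (gauss2 t x).
Proof.
apply: measurable_funM; apply: measurableT_comp (measurable_gauss t x) _.
  exact: measurable_fst.
exact: measurable_snd.
Qed.

Local Notation mu2 := (@lebesgue_measure R \x @lebesgue_measure R)%E.

(** Each velocity integral contributes a square root; their product decays like [t ^- 2], which
    makes it integrable in time. *)
Lemma integral_gauss2_le t x :
  (\int[mu2]_u (gauss2 t x u)%:E <= (pi / (be + al * t ^+ 2))%:E)%E.
Proof.
have k0 : 0 < be + al * t ^+ 2 by rewrite ltr_wpDr// mulr_ge0 ?sqr_ge0 ?ltW.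
set k := be + al * t ^+ 2 in k0 *.
have pk0 : 0 <= pi / k by rewrite divr_ge0 ?pi_ge0 ?ltW.
have W0 v : (0 <= (W t x v)%:E)%E by rewrite lee_fin gauss_ge0.
rewrite (fubini_tonelli1 (m1 := @lebesgue_measure R) (m2 := @lebesgue_measure R)
  (fun u => (gauss2 t x u)%:E)); last 2 first.
- by apply/measurable_EFinP; exact: measurable_gauss2.
- by move=> u; rewrite lee_fin mulr_ge0 ?gauss_ge0.
rewrite /fubini_F /gauss2/=.
under eq_integral => v _.
  under eq_integral do rewrite EFinM.
  rewrite ge0_integralZl//; last exact: measurable_EgaussE.
  rewrite muleC; over.
rewrite ge0_integralZl//; last 2 first.
- exact: measurable_EgaussE.
- exact: integral_ge0.
rewrite -[in leRHS](sqr_sqrtr pk0) expr2 EFinM.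
by apply: lee_pmul; rewrite ?integral_ge0 ?integral_gauss_le.
Qed.

Lemma integrable_gauss2 t x : mu2.-integrable setT (EFin \o gauss2 t x).
Proof.
apply/integrableP; split; first by apply/measurable_EFinP; exact: measurable_gauss2.
under eq_integral => u _.
  rewrite /= ger0_norm; last by rewrite mulr_ge0 ?gauss_ge0.
  over.
exact: le_lt_trans (integral_gauss2_le t x) (ltry _).
Qed.

Lemma Rintegral_gauss2_le t x :
  \int[mu2]_u gauss2 t x u <= pi / (be + al * t ^+ 2).
Proof.
rewrite /Rintegral -lee_fin fineK ?integral_gauss2_le//.
exact: integrable_fin_num (integrable_gauss2 t x).
Qed.

Definition ellipse_length : R := fine (hausdorff1 (@ellipse R)).

Lemma ellipse_length_ge0 : 0 <= ellipse_length.
Proof. exact/fine_ge0/hausdorff1_ge0. Qed.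

Lemma ellipse_integral_dist (k l : R * R -> R) (P E : R) :
  measurable_fun setT k -> measurable_fun setT l ->
  (forall z, disc z = 1 -> [/\ `|k z| <= P, `|l z| <= P & `|k z - l z| <= E]) ->
  [/\ `|\int[@hausdorff1 R]_(z in @ellipse R) k z| <= P * ellipse_length,
      `|\int[@hausdorff1 R]_(z in @ellipse R) l z| <= P * ellipse_length &
   `|\int[@hausdorff1 R]_(z in @ellipse R) k z -
    \int[@hausdorff1 R]_(z in @ellipse R) l z| <= E * ellipse_length].
Proof.
move=> mk ml kl.
have me := @measurable_ellipse R.
have icst c : (@hausdorff1 R).-integrable (@ellipse R) (EFin \o cst c).
  apply/integrableP; split; first by apply/measurable_EFinP; exact: measurable_cst.
  rewrite (integral_cst _ me `|c|%:E).
  by rewrite lte_mul_pinfty ?lee_fin// hausdorff1_ellipse.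
have cstE c : \int[@hausdorff1 R]_(z in @ellipse R) c = c * ellipse_length.
  by rewrite Rintegral_cst.
have bnd (h : R * R -> R) (c : R) : measurable_fun setT h ->
    (forall z, disc z = 1 -> `|h z| <= c) ->
    `|\int[@hausdorff1 R]_(z in @ellipse R) h z| <= c * ellipse_length /\
    (@hausdorff1 R).-integrable (@ellipse R) (EFin \o h).
  move=> mh hc.
  have ih : (@hausdorff1 R).-integrable (@ellipse R) (EFin \o h).
    apply: (le_integrable me) (icst c).
      by apply/measurable_EFinP; exact: measurable_funTS.
    by move=> z /hc hz; rewrite lee_fin (le_trans hz)// ler_norm.
  split => //; apply: le_trans (le_normr_Rintegral me ih) _.
  rewrite -cstE; apply: le_Rintegral => //.
    exact: integrable_norm ih.
  exact: icst.
have kleP z : disc z = 1 -> `|k z| <= P by move=> /kl[].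
have lleP z : disc z = 1 -> `|l z| <= P by move=> /kl[].
have [kP ik] := bnd k P mk kleP.
have [lP il] := bnd l P ml lleP.
split => //; rewrite -RintegralB//.
have [||//] := bnd (fun z => k z - l z) E.
  exact: measurable_funB.
by move=> z /kl[].
Qed.

(** Integrating [collision_kernel_close] over the ellipse costs [ellipse_length], and over [u] it
    costs [pi / (be + al * t ^+ 2)]. The weight at [v] stays outside. *)
Lemma C6_close f g M D t x v : jointly_measurable f -> jointly_measurable g ->
  0 <= M -> 0 <= D ->
  (forall y, close M D (W t x y) (f t x y) (g t x y)) ->
  `|C6 f t x v - C6 g t x v| <=
    30 * pi * ellipse_length * M ^+ 4 * D / (be + al * t ^+ 2) * W t x v.
Proof.
move=> mf mg M0 D0 fg; rewrite !C6E//.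
have mker h u : jointly_measurable h ->
    measurable_fun setT (collision_kernel h t x v u).
  move=> mh; apply: (measurableT_comp (measurable_collision_kernel mh)
    (g := fun z => ((t, x, v), u, z))).
  exact: pair1_measurable.
pose J (h : R -> R -> R -> R) u : R :=
  \int[@hausdorff1 R]_(z in @ellipse R) collision_kernel h t x v u z.
have mJ h : jointly_measurable h -> measurable_fun setT (J h).
  move=> mh; apply: measurable_Rintegral_restr_param.
  - exact: measurable_ellipse.
  - exact: hausdorff1_ellipse.
  - apply: (measurableT_comp (measurable_collision_kernel mh)
      (g := fun q => ((t, x, v), q.1, q.2))).
    apply: measurable_fun_pair; last exact: measurable_snd.
    by apply: measurable_fun_pair => //; exact: measurable_fst.
(* [A] serves to justify integrability, while [B] carries the actual estimate. *)
pose A := 6 * M ^+ 5 * W t x v * ellipse_length.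
pose B := 30 * M ^+ 4 * D * W t x v * ellipse_length.
have Jb u : [/\ `|J f u| <= A * gauss2 t x u, `|J g u| <= A * gauss2 t x u &
    `|J f u - J g u| <= B * gauss2 t x u].
  have [h1 h2 h3] := ellipse_integral_dist (mker f u mf) (mker g u mg)
    (fun z hz => collision_kernel_close v u M0 D0 fg hz).
  by split; [apply: le_trans h1 _|apply: le_trans h2 _|apply: le_trans h3 _];
    rewrite le_eqVlt; apply/orP; left; apply/eqP; rewrite /A /B /gauss2; ring.
have g20 u : 0 <= gauss2 t x u by rewrite mulr_ge0 ?gauss_ge0.
have ig c : mu2.-integrable setT (EFin \o (fun u => c * gauss2 t x u)).
  exact: integrableZl (integrable_gauss2 t x).
have iJ h : jointly_measurable h -> (forall u, `|J h u| <= A * gauss2 t x u) ->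
    mu2.-integrable setT (EFin \o J h).
  move=> mh hA; apply: (le_integrable measurableT) (ig A).
    by apply/measurable_EFinP; exact: mJ.
  by move=> u _; rewrite lee_fin (le_trans (hA u))// ler_norm.
have iJf := iJ f mf (fun u => let: And3 h _ _ := Jb u in h).
have iJg := iJ g mg (fun u => let: And3 _ h _ := Jb u in h).
rewrite -[X in `|X|](RintegralB measurableT iJf iJg).
have iJB : mu2.-integrable setT (EFin \o (fun u => J f u - J g u)).
  exact: (integrableB measurableT iJf iJg).
apply: le_trans (le_normr_Rintegral measurableT iJB) _.
apply: (@le_trans _ _ (\int[mu2]_u (B * gauss2 t x u))).
  apply: le_Rintegral => //; first exact: integrable_norm iJB.
  by move=> u _; have [] := Jb u.
rewrite RintegralZl//; last exact: integrable_gauss2.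
have B0 : 0 <= B.
  by rewrite !mulr_ge0 ?exprn_ge0 ?ellipse_length_ge0 ?pi_ge0 ?gauss_ge0.
apply: le_trans (ler_wpM2l B0 (Rintegral_gauss2_le t x)) _.
by rewrite le_eqVlt; apply/orP; left; apply/eqP; rewrite /B; ring.
Qed.

End CollisionEstimate.

(** * Integrals in time *)

Section TimeIntegral.
Context {R : realType}.
Local Notation integral0 := Defs.integral0.
Implicit Types (g h b F : R -> R) (s t : R).

Lemma Rintegral_derive F (f : R -> R) (a b : R) : a <= b ->
  (forall x : R, is_derive x 1 F (f x)) -> continuous f ->
  \int[lebesgue_measure]_(x in `[a, b]) f x = F b - F a.
Proof.
rewrite le_eqVlt => /predU1P[->|ab] dF cf.
  by rewrite set_itv1 Rintegral_set1 subrr.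
have cF : continuous F.
  move=> x; apply/differentiable_continuous/derivable1_diffP.
  exact: (@ex_derive _ _ _ _ _ _ _ (dF x)).
rewrite /Rintegral (@continuous_FTC2 _ _ F)//.
- exact: continuous_subspaceT.
- split.
  + by move=> x _; exact: (@ex_derive _ _ _ _ _ _ _ (dF x)).
  + by apply: cvg_at_right_filter; exact: cF.
  + by apply: cvg_at_left_filter; exact: cF.
- by move=> x _; rewrite derive1E; apply: (@derive_val _ _ _ _ _ _ _ (dF x)).
Qed.

(** The orientation is left to the sign in [integral0_span], so that norm estimates treat both time
    directions at once. *)
Definition time_span t : set R := if 0 <= t then `[0, t]%classic else `[t, 0]%classic.

Lemma measurable_time_span t : measurable (time_span t).
Proof. by rewrite /time_span; case: ifP. Qed.

Lemma integral0_span g t :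
  integral0 g t = (if 0 <= t then 1 else -1) *
    \int[lebesgue_measure]_(s in time_span t) g s.
Proof. by rewrite /integral0 /time_span; case: ifP; rewrite ?mul1r ?mulN1r. Qed.

Lemma bounded_integrable_span g (C : R) t : measurable_fun setT g ->
  (forall s, `|g s| <= C) ->
  lebesgue_measure.-integrable (time_span t) (EFin \o g).
Proof.
move=> mg gC; have mT := measurable_time_span t.
have iC : lebesgue_measure.-integrable (time_span t) (EFin \o cst C).
  apply/integrableP; split; first by apply/measurable_EFinP; exact: measurable_cst.
  have -> : (\int[lebesgue_measure]_(x in time_span t) `|(EFin \o cst C) x| =
      `|C|%:E * lebesgue_measure (time_span t))%E.
    exact: (@integral_cst _ _ _ (@lebesgue_measure R) _ mT `|C|%:E).
  rewrite lte_mul_pinfty ?lee_fin//.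
  by rewrite /time_span; case: ifP => _; rewrite lebesgue_measure_itv/=;
    case: ifP; rewrite -?EFinB ltry.
apply: (@le_integrable _ _ _ (@lebesgue_measure R) _ mT _ _ _ _ iC).
  by apply/measurable_EFinP; exact: measurable_funTS.
by move=> s _; rewrite lee_fin (le_trans (gC s))// ler_norm.
Qed.

Lemma integral0_dist g h b (C : R) t : measurable_fun setT g -> measurable_fun setT h ->
  (forall s, `|g s| <= C) -> (forall s, `|h s| <= C) ->
  lebesgue_measure.-integrable (time_span t) (EFin \o b) ->
  (forall s, time_span t s -> `|g s - h s| <= b s) ->
  `|integral0 g t - integral0 h t| <= \int[lebesgue_measure]_(s in time_span t) b s.
Proof.
move=> mg mh gC hC ib ghb; have mT := measurable_time_span t.
have ig := bounded_integrable_span t mg gC.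
have ih := bounded_integrable_span t mh hC.
rewrite !integral0_span -mulrBr normrM.
rewrite (_ : `|if _ then _ else _| = 1); last by case: ifP; rewrite ?normrN normr1.
rewrite mul1r -RintegralB//.
have igh : lebesgue_measure.-integrable (time_span t) (EFin \o (fun s => g s - h s)).
  exact: (@integrableB _ _ _ (@lebesgue_measure R) _ mT _ _ ig ih).
have := @le_normr_Rintegral _ _ _ (@lebesgue_measure R) _ _ mT igh.
move=> /le_trans; apply; apply: (@le_Rintegral _ _ _ (@lebesgue_measure R)) => //.
exact: (@integrable_norm _ _ _ (@lebesgue_measure R) _ _ igh).
Qed.

(** The bounds of integration vary with the parameter; they are moved into the integrand as an
    indicator, which leaves an integral over the whole line. *)
Lemma measurable_integral0 d (X : measurableType d) (k : X -> R -> R) (t : X -> R) :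
  measurable_fun setT t -> measurable_fun setT (fun q : X * R => k q.1 q.2) ->
  measurable_fun setT (fun x => integral0 (k x) (t x)).
Proof.
move=> mt mk; pose chi (P : bool) : R := if P then 1 else 0.
have span (g : R -> R) (a b : R) : \int[lebesgue_measure]_(s in `[a, b]) g s =
    \int[lebesgue_measure]_s (g s * chi (a <= s <= b)).
  rewrite Rintegral_mkcond; apply: eq_Rintegral => s _.
  by rewrite patchE mem_setE in_itv/= /chi; case: ifP; rewrite ?mulr1 ?mulr0.
have mchi (a b : X * R -> R) : measurable_fun setT a -> measurable_fun setT b ->
    measurable_fun setT (fun q => chi (a q <= q.2 <= b q)).
  move=> ma mb; apply: measurable_fun_ifT => //; apply: measurable_and.
    by apply: measurable_fun_ler => //; exact: measurable_snd.
  by apply: measurable_fun_ler => //; exact: measurable_snd.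
have mt1 : measurable_fun setT (fun q : X * R => t q.1).
  by apply: measurableT_comp mt _; exact: measurable_fst.
rewrite (_ : (fun x => _) = fun x => if 0 <= t x then
    \int[lebesgue_measure]_s (k x s * chi (0 <= s <= t x)) else
    - \int[lebesgue_measure]_s (k x s * chi (t x <= s <= 0))); last first.
  by apply/funext => x; rewrite /Defs.integral0 !span.
apply: measurable_fun_ifT.
- by apply: measurable_fun_ler.
- apply: (@measurable_Rintegral_param _ _ X _ _ (@lebesgue_measure R)
    (fun x s => k x s * chi (0 <= s <= t x))).
  by apply: measurable_funM => //; exact: mchi.
- apply: measurableT_comp => //.
  apply: (@measurable_Rintegral_param _ _ X _ _ (@lebesgue_measure R)
    (fun x s => k x s * chi (t x <= s <= 0))).
  by apply: measurable_funM => //; exact: mchi.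
Qed.

Section Kappa.
Context (al be : R) (al0 : 0 < al) (be0 : 0 < be).

Lemma continuous_kappa : continuous (fun s : R => (be + al * s ^+ 2)^-1).
Proof.
move=> s; apply: cvgV.
  by rewrite gt_eqF// ltr_wpDr// mulr_ge0 ?sqr_ge0// ltW.
apply: cvgD; first exact: cvg_cst.
by apply: cvgM; [exact: cvg_cst|exact: exprn_continuous].
Qed.

Lemma Rintegral_kappa_le t :
  \int[lebesgue_measure]_(s in time_span t) (be + al * s ^+ 2)^-1 <=
  pi / Num.sqrt (al * be).
Proof.
pose p := Num.sqrt al; pose q := Num.sqrt be.
have p0 : 0 < p by rewrite sqrtr_gt0.
have q0 : 0 < q by rewrite sqrtr_gt0.
have pE : p ^+ 2 = al by rewrite sqr_sqrtr// ltW.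
have qE : q ^+ 2 = be by rewrite sqr_sqrtr// ltW.
(* A primitive of the integrand. The arctangent varies by less than [pi], so the bound is uniform in
   [t]. *)
pose F s := atan (p / q * s) / (p * q).
have dF s : is_derive s 1 F ((be + al * s ^+ 2)^-1).
  have dl : is_derive s 1 (fun y : R => p / q * y) (p / q).
    by apply: is_derive_eq; rewrite /GRing.scale/= mulr1.
  have h := is_derive1_comp (is_derive1_atan (p / q * s)) dl.
  have -> : F = fun y => (p * q)^-1 *: (atan \o (fun y : R => p / q * y)) y.
    by apply/funext => y; rewrite /F mulrC.
  apply: is_derive_eq; rewrite /GRing.scale/=.
  have k0 : q ^+ 2 + p ^+ 2 * s ^+ 2 != 0.
    by rewrite gt_eqF// ltr_wpDr ?exprn_gt0// mulr_ge0 ?sqr_ge0.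
  have k1 : 1 + (p / q * s) ^+ 2 != 0 by rewrite gt_eqF// ltr_wpDr ?sqr_ge0.
  rewrite -pE -qE; field.
  by rewrite exprMn k0 !gt_eqF.
have pi2 (a b : R) : F b - F a <= pi / (p * q).
  rewrite /F -mulrBl ler_pM2r ?invr_gt0 ?mulr_gt0//.
  have := atan_ltpi2 (p / q * b); have := atan_gtNpi2 (p / q * a); lra.
rewrite sqrtrM ?(ltW al0)// -/p -/q /time_span; case: ifP => t0.
  by rewrite (Rintegral_derive t0 dF continuous_kappa).
have {}t0 : t <= 0 by rewrite ltW// ltNge t0.
by rewrite (Rintegral_derive t0 dF continuous_kappa).
Qed.

End Kappa.

(** On either half line an explicit primitive gives [expR (la * |t|) - 1]. *)
Lemma Rintegral_exp_le (la t : R) : 0 < la ->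
  \int[lebesgue_measure]_(s in time_span t) (la * expR (la * `|s|)) <= expR (la * `|t|).
Proof.
move=> la0.
have dE (c s : R) : is_derive s 1 (fun y => expR (c * y)) (c * expR (c * s)).
  have dl : is_derive s 1 (fun y : R => c * y) c.
    by apply: is_derive_eq; rewrite /GRing.scale/= mulr1.
  by have := is_derive1_comp (is_derive_expR (c * s)) dl; rewrite mulrC.
have dNE s : is_derive s 1 (fun y => - expR (- la * y)) (la * expR (- la * s)).
  have := dE (- la) s => dE'; apply: is_derive_eq.
  by rewrite mulNr opprK.
have cE (c : R) : continuous (fun s : R => la * expR (c * s)).
  move=> s; apply: cvgM; first exact: cvg_cst.
  apply: continuous_comp; last exact: continuous_expR.
  by apply: cvgM; [exact: cvg_cst|exact: cvg_id].
rewrite /time_span; case: ifP => t0.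
  rewrite (@eq_Rintegral _ _ _ lebesgue_measure _
    (fun s => la * expR (la * s))); last first.
    by move=> s; rewrite inE/= in_itv/= => /andP[s0 _]; rewrite ger0_norm.
  rewrite (Rintegral_derive t0 (dE la) (cE la)).
  by rewrite (ger0_norm t0) gerBl expR_ge0.
have {}t0 : t <= 0 by rewrite ltW// ltNge t0.
rewrite (@eq_Rintegral _ _ _ lebesgue_measure _
  (fun s => la * expR (- la * s))); last first.
  by move=> s; rewrite inE/= in_itv/= => /andP[_ s0]; rewrite ler0_norm// mulrN mulNr.
rewrite (Rintegral_derive t0 dNE (cE (- la))).
by rewrite (ler0_norm t0) mulr0 expR0 opprK addrC mulrN -mulNr gerBl.
Qed.

End TimeIntegral.

(** * Limits of sequences with geometrically small increments *)

Section GeometricLimit.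
Context {R : realType}.
Implicit Types (a b c : R) (u : nat -> R).

Lemma le_add_geometric a b c : (forall n, a <= b + c / 2 ^+ n) -> a <= b.
Proof.
move=> h; rewrite leNgt; apply/negP => ba.
have c0 : 0 < c by have := h 0%N; rewrite expr0 divr1; lra.
pose n := (Num.trunc (c / (a - b))).+1.
have cn : c / (a - b) < 2 ^+ n.
  apply: (@lt_trans _ _ n%:R); last by rewrite -natrX ltr_nat ltn_expl.
  by have /andP[] := truncn_itv (divr_ge0 (ltW c0) (ltW (eqbRL (subr_gt0 _ _) ba))).
have := h n; rewrite -lerBlDl leNgt ltr_pdivrMr ?exprn_gt0//.
by rewrite mulrC -ltr_pdivrMr ?subr_gt0// cn.
Qed.

(** The intervals from [L n] to [U n] are nested and shrink to a point; [L] converges by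
    monotonicity and [u] follows. *)
Lemma geometric_cvg u c : (forall n, `|u n.+1 - u n| <= c / 2 ^+ n) ->
  cvgn u /\ forall n, `|limn u - u n| <= 2 * c / 2 ^+ n.
Proof.
move=> uc.
(* [2 * c / 2 ^+ n] is the sum of all increment bounds from index [n] on. *)
have half n : 2 * c / 2 ^+ n = 2 * c / 2 ^+ n.+1 + c / 2 ^+ n.
  by rewrite exprS; field; rewrite expf_neq0.
pose L n := u n - 2 * c / 2 ^+ n; pose U n := u n + 2 * c / 2 ^+ n.
have ndL : nondecreasing_seq L.
  apply/nondecreasing_seqP => n; have := uc n; have := half n.
  by rewrite ler_norml /L => + /andP[]; lra.
have niU : nonincreasing_seq U.
  apply/nonincreasing_seqP => n; have := uc n; have := half n.
  by rewrite ler_norml /U => + /andP[]; lra.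
have c0 : 0 <= c by have := le_trans (normr_ge0 _) (uc 0%N); rewrite expr0 divr1.
have LU n : L n <= U n.
  have : 0 <= 2 * c / 2 ^+ n by rewrite divr_ge0 ?mulr_ge0 ?exprn_ge0.
  by rewrite /L /U; lra.
have cL : cvgn L.
  apply: nondecreasing_is_cvgn => //; exists (U 0%N) => _ [n _ <-].
  exact: le_trans (LU n) (niU _ _ (leq0n n)).
have g0 : (2 * c / 2 ^+ n) @[n --> \oo] --> (0 : R).
  rewrite (_ : (fun n => _) = geometric (2 * c) (2^-1)).
    by apply: cvg_geometric; rewrite ger0_norm ?invr_ge0// invf_lt1 ?ltr1n.
  by apply/funext => n; rewrite /geometric/= exprVn.
have uL : u @ \oo --> limn L.
  rewrite -[limn L]addr0 (_ : u = fun n => L n + 2 * c / 2 ^+ n).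
    exact: cvgD.
  by apply/funext => n; rewrite /L subrK.
have lu : limn u = limn L by exact: cvg_lim.
split=> [|n]; first by apply/cvg_ex; exists (limn L).
have := nondecreasing_cvgn_le ndL cL n; rewrite -lu {1}/L => h1.
have h2 : limn L <= U n.
  apply: limr_le => //; near=> m; apply: le_trans (LU m) (niU _ _ _).
  by near: m; exact: nbhs_infty_ge.
by rewrite ler_norml; move: h2; rewrite -lu /U; lra.
Unshelve. all: by end_near.
Qed.

End GeometricLimit.

(** * Duhamel estimates *)

Section Duhamel.
Context {R : realType} (al be : R) (al0 : 0 < al) (be0 : 0 < be).
Local Notation W := (gauss al be).
Local Notation integral0 := Defs.integral0.
Implicit Types (f g : R -> R -> R -> R) (s t x v y M : R).

Definition bounded_by M f := forall t x v, `|f t x v| <= M * W t x v.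

Definition collision_const : R := 30 * pi * @ellipse_length R.

Lemma collision_const_ge0 : 0 <= collision_const.
Proof. by rewrite !mulr_ge0 ?pi_ge0 ?ellipse_length_ge0. Qed.

Lemma jointly_measurable0 : jointly_measurable (fun _ _ _ : R => 0 : R).
Proof. exact: measurable_cst. Qed.

Lemma C6_0 t x v : C6 (fun _ _ _ : R => 0 : R) t x v = 0.
Proof.
rewrite C6E; last exact: jointly_measurable0.
rewrite /Rintegral integral0_eq// => u _; rewrite integral0_eq// => z _.
by rewrite /collision_kernel /C6_integrand !(mul0r, mulr0, subrr).
Qed.

Lemma gauss_shift s t x v : W s (x - t * v + s * v) v = W t x v.
Proof. by rewrite /gauss addrK. Qed.

(** This is [C6_close] against the zero function, with [D = M]. The bound is uniform, so the
    collision term is integrable on bounded time spans. *)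
Lemma C6_bounded f M t x v : jointly_measurable f -> 0 <= M -> bounded_by M f ->
  `|C6 f t x v| <= collision_const * M ^+ 5 / be.
Proof.
move=> mf M0 fM; rewrite -[C6 f t x v]subr0 -(C6_0 t x v).
apply: le_trans (C6_close al0 be0 _ mf jointly_measurable0 M0 M0 _) _.
  by move=> y; split; rewrite ?normr0 ?subr0 ?mulr_ge0 ?gauss_ge0.
have KM : 0 <= collision_const * M ^+ 5.
  by rewrite mulr_ge0 ?collision_const_ge0 ?exprn_ge0.
have k0 : be <= be + al * t ^+ 2 by rewrite lerDl mulr_ge0 ?sqr_ge0 ?ltW.
apply: (@le_trans _ _ (collision_const * M ^+ 5 / (be + al * t ^+ 2))).
  rewrite -/collision_const -(mulrA _ (M ^+ 4)) -exprSr.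
  by rewrite ler_piMr ?gauss_le1 ?divr_ge0// (le_trans (ltW be0)).
by rewrite ler_wpM2l// lef_pV2 ?posrE// (lt_le_trans be0).
Qed.

(** The collision term at time [s] on the free trajectory that passes through [x] at time [t] with
    velocity [v]. *)
Definition along f t x v s := C6 f s (x - t * v + s * v) v.

Lemma measurable_along f t x v : jointly_measurable f ->
  measurable_fun setT (along f t x v).
Proof.
move=> mf; apply: measurable_comp3 => //; first exact: jointly_measurable_C6.
by apply: measurable_funD => //; exact: measurable_funM.
Qed.

(** By [gauss_shift] the Gaussian is constant along a trajectory and leaves the time integral. The
    distance [D] may vary with time, so that both a uniform and an exponentially weighted
    contraction follow. *)
Lemma duhamel_dist f g M (D b : R -> R) t x v :
  jointly_measurable f -> jointly_measurable g -> 0 <= M ->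
  bounded_by M f -> bounded_by M g -> (forall s, 0 <= D s) ->
  (forall s y u, `|f s y u - g s y u| <= D s * W s y u) ->
  lebesgue_measure.-integrable (time_span t) (EFin \o b) ->
  (forall s, collision_const * M ^+ 4 * D s / (be + al * s ^+ 2) <= b s) ->
  `|integral0 (along f t x v) t - integral0 (along g t x v) t| <=
    (\int[lebesgue_measure]_(s in time_span t) b s) * W t x v.
Proof.
move=> mf mg M0 fM gM D0 fgD ib hb.
rewrite mulrC -RintegralZl//; last exact: measurable_time_span.
apply: (@integral0_dist _ _ _ _ (collision_const * M ^+ 5 / be)).
- exact: measurable_along.
- exact: measurable_along.
- by move=> s; exact: C6_bounded.
- by move=> s; exact: C6_bounded.
- exact: (@integrableZl _ _ _ (@lebesgue_measure R) _ (measurable_time_span t) _ _ ib).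
move=> s _; rewrite -(gauss_shift s t x v).
apply: le_trans (C6_close al0 be0 _ mf mg M0 (D0 s) _) _.
  by move=> y; split; [exact: fM|exact: gM|exact: fgD].
by rewrite mulrC ler_wpM2l ?gauss_ge0.
Qed.

Definition time_const : R := collision_const * (pi / Num.sqrt (al * be)).

Lemma integrable_continuous_span (b : R -> R) t : continuous b ->
  lebesgue_measure.-integrable (time_span t) (EFin \o b).
Proof.
move=> cb; rewrite /time_span; case: ifP => _;
  by apply: continuous_compact_integrable;
    [exact: segment_compact|exact: continuous_subspaceT].
Qed.

(** The decay of the collision estimate is integrable over the whole line, which makes the constant
    independent of [t]. *)
Lemma duhamel_contraction f g M D t x v :
  jointly_measurable f -> jointly_measurable g -> 0 <= M -> 0 <= D ->
  bounded_by M f -> bounded_by M g ->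
  (forall s y u, `|f s y u - g s y u| <= D * W s y u) ->
  `|integral0 (along f t x v) t - integral0 (along g t x v) t| <=
    time_const * M ^+ 4 * D * W t x v.
Proof.
move=> mf mg M0 D0 fM gM fgD.
pose b s : R := collision_const * M ^+ 4 * D * (be + al * s ^+ 2)^-1.
have ik := integrable_continuous_span t (continuous_kappa al0 be0).
apply: le_trans (@duhamel_dist f g M (fun=> D) b t x v _ _ _ _ _ _ _ _ _) _ => //.
  exact: (@integrableZl _ _ _ (@lebesgue_measure R) _ (measurable_time_span t) _ _ ik).
rewrite ler_wpM2r ?gauss_ge0//.
rewrite RintegralZl//; last exact: measurable_time_span.
have A0 : 0 <= collision_const * M ^+ 4 * D.
  by rewrite mulr_ge0// mulr_ge0 ?collision_const_ge0 ?exprn_ge0.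
apply: le_trans (ler_wpM2l A0 (Rintegral_kappa_le al0 be0 t)) _.
by rewrite le_eqVlt; apply/orP; left; apply/eqP; rewrite /time_const; ring.
Qed.

Lemma duhamel_bounded f M t x v : jointly_measurable f -> 0 <= M -> bounded_by M f ->
  `|integral0 (along f t x v) t| <= time_const * M ^+ 5 * W t x v.
Proof.
move=> mf M0 fM.
have z0 : integral0 (along (fun _ _ _ => 0) t x v) t = 0.
  rewrite integral0_span /Rintegral integral0_eq ?mulr0// => s _.
  by rewrite /along C6_0.
rewrite -[X in `|X|]subr0 -z0 (exprSr M 4) mulrA.
apply: duhamel_contraction => //; first exact: jointly_measurable0.
  by move=> s y u; rewrite normr0 mulr_ge0 ?gauss_ge0.
by move=> s y u; rewrite subr0.
Qed.

(* The weight [expR (la * `|t|)] makes the Duhamel operator a contraction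
   whatever the size of [M], hence uniqueness among all mild solutions. *)
Lemma duhamel_exp_contraction f g M D t x v :
  let la := 2 * (collision_const * M ^+ 4 / be) + 1 in
  jointly_measurable f -> jointly_measurable g -> 0 <= M -> 0 <= D ->
  bounded_by M f -> bounded_by M g ->
  (forall s y u, `|f s y u - g s y u| <= D * expR (la * `|s|) * W s y u) ->
  `|integral0 (along f t x v) t - integral0 (along g t x v) t| <=
    D / 2 * expR (la * `|t|) * W t x v.
Proof.
move=> la mf mg M0 D0 fM gM fgD.
have A1 : 0 <= collision_const * M ^+ 4.
  by apply: mulr_ge0; [exact: collision_const_ge0|exact: exprn_ge0].
have A0 : 0 <= collision_const * M ^+ 4 / be by rewrite divr_ge0 ?(ltW be0).
have la0 : 0 < la by rewrite /la; lra.
pose e s := la * expR (la * `|s|).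
have ie : lebesgue_measure.-integrable (time_span t) (EFin \o e).
  apply: integrable_continuous_span => s; apply: cvgM; first exact: cvg_cst.
  apply: continuous_comp; last exact: continuous_expR.
  by apply: cvgM; [exact: cvg_cst|exact: norm_continuous].
apply: le_trans (@duhamel_dist f g M (fun s => D * expR (la * `|s|))
  (fun s => D / 2 * e s) t x v _ _ _ _ _ _ _ _ _) _ => //.
- by move=> s; rewrite mulr_ge0 ?expR_ge0.
- exact: (@integrableZl _ _ _ (@lebesgue_measure R) _ (measurable_time_span t) _ _ ie).
- move=> s; rewrite /e; set E := expR _.
  have De : 0 <= D * E by rewrite mulr_ge0 ?expR_ge0.
  apply: (@le_trans _ _ (collision_const * M ^+ 4 / be * (D * E))).
    rewrite mulrAC ler_wpM2r// ler_wpM2l//.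
    have k0 : be <= be + al * s ^+ 2 by rewrite lerDl mulr_ge0 ?sqr_ge0 ?ltW.
    by rewrite lef_pV2 ?posrE// (lt_le_trans be0).
  (* [la] exceeds twice the Lipschitz constant of the collision term, which is where the factor 1/2
     comes from. *)
  rewrite (_ : D / 2 * _ = la / 2 * (D * E)); last by ring.
  by rewrite ler_wpM2r// /la; lra.
rewrite ler_wpM2r ?gauss_ge0// RintegralZl//; last exact: measurable_time_span.
by rewrite ler_wpM2l ?divr_ge0//; exact: Rintegral_exp_le.
Qed.

End Duhamel.

(** * Positivity forward in time and truncation *)

Section ForwardPositivity.
Context {R : realType}.
Local Notation integral0 := Defs.integral0.
Implicit Types (f : R -> R -> R -> R) (a C s t x v y : R).

(** If [phi t < 0], let [sup S] be the supremum of the times up to [t] at which [phi] is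
    nonnegative. After it [g] is nonnegative, so [phi (sup S) <= phi t < 0]; but [phi] is
    nonnegative arbitrarily close before it and decreases at rate at most [C]. *)
Lemma ge0_integral0 (g : R -> R) a C : 0 <= a -> measurable_fun setT g ->
  (forall s, `|g s| <= C) ->
  (forall s, 0 <= s -> a + integral0 g s < 0 -> 0 <= g s) ->
  forall t, 0 <= t -> 0 <= a + integral0 g t.
Proof.
move=> a0 mg gC gsign t t0; rewrite leNgt; apply/negP.
pose phi s := a + integral0 g s; rewrite -/(phi t) => phit.
have C0 : 0 <= C := le_trans (normr_ge0 _) (gC 0).
have ig (h : R -> R) b : measurable_fun setT h -> (forall s, `|h s| <= C) ->
    0 <= b -> lebesgue_measure.-integrable `[0, b] (EFin \o h).
  by move=> mh hC b0; have := bounded_integrable_span b mh hC; rewrite /time_span b0.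
have phiB b c : 0 <= b -> b <= c ->
    phi c - phi b = \int[lebesgue_measure]_(s in `]b, c]) g s.
  move=> b0 bc; have c0 := le_trans b0 bc.
  rewrite /phi /Defs.integral0 b0 c0 opprD addrACA subrr add0r.
  by apply: Rintegral_itvB; rewrite ?bnd_simp//; apply: ig.
have ig' (h : R -> R) b c : measurable_fun setT h -> (forall s, `|h s| <= C) ->
    0 <= b -> b <= c -> lebesgue_measure.-integrable `]b, c] (EFin \o h).
  move=> mh hC b0 bc; apply: integrableS (ig h c mh hC (le_trans b0 bc)) => //.
  by apply: subset_itv; rewrite bnd_simp.
have phi_lip b c : 0 <= b -> b <= c -> - (C * (c - b)) <= phi c - phi b.
  move=> b0 bc; rewrite (phiB _ _ b0 bc).
  have m1 : measurable (`]b, c]%classic : set R) by [].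
  have igbc := ig' g _ _ mg gC b0 bc.
  have := @le_normr_Rintegral _ _ _ (@lebesgue_measure R) _ _ m1 igbc.
  have : \int[lebesgue_measure]_(s in `]b, c]) `|g s| <=
      \int[lebesgue_measure]_(s in `]b, c]) C.
    apply: (@le_Rintegral _ _ _ (@lebesgue_measure R)) => //.
    - exact: (@integrable_norm _ _ _ (@lebesgue_measure R) _ _ igbc).
    - by apply: (ig' (cst C)) => // s; rewrite ger0_norm.
  have -> : \int[lebesgue_measure]_(s in `]b, c]) C = C * (c - b).
    transitivity (C * fine (@lebesgue_measure R `]b, c]%classic)).
      exact: (@Rintegral_cst _ _ _ (@lebesgue_measure R) _ m1).
    rewrite lebesgue_measure_itv/= lte_fin; case: ltP => // cb.
    by rewrite (@le_anti _ _ b c) ?bc// subrr.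
  move=> gle; rewrite ler_norml => /andP[+ _]; apply: le_trans.
  by rewrite lerN2.
have phi0 : 0 <= phi 0.
  by rewrite /phi /Defs.integral0 lexx set_itv1 Rintegral_set1 addr0.
pose S := [set s | 0 <= s <= t /\ 0 <= phi s].
have S0 : S 0 by split; rewrite ?lexx ?t0.
have supS : has_sup S by split; [exists 0|exists t => s [/andP[_ ?] _]].
have s0 : 0 <= sup S by apply: sup_upper_bound.
have st : sup S <= t by apply: ge_sup; [exists 0|move=> s [/andP[_ ?] _]].
have after : phi (sup S) <= phi t.
  rewrite -subr_ge0 phiB//; apply: Rintegral_ge0 => s.
  rewrite /= in_itv/= => /andP[h1 h2].
  apply: gsign; first exact: le_trans s0 (ltW h1).
  rewrite ltNge; apply/negP => phis; move: (h1); rewrite ltNge => /negP; apply.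
  apply: sup_upper_bound => //; split => //; rewrite h2 andbT.
  exact: le_trans s0 (ltW h1).
(* Chosen so that [C * e < - phi t]: within [e] of the supremum, [phi] cannot drop from a
   nonnegative value to [phi t]. The denominator [C + 1] is positive even if [C = 0]. *)
pose e := - phi t / (C + 1).
have e0 : 0 < e by rewrite divr_gt0 ?oppr_gt0//; lra.
have [r [/andP[r0 rt] phir] er] := sup_adherent e0 supS.
have rs : r <= sup S by apply: sup_upper_bound => //; split => //; rewrite r0.
have := phi_lip r (sup S) r0 rs.
have : C * (sup S - r) <= C * e by rewrite ler_wpM2l//; lra.
have : (C + 1) * e = - phi t by rewrite /e mulrC divfK// gt_eqF//; lra.
lra.
Qed.

(** Negative times are left untouched, so that a solution nonnegative forward in time is a fixed
    point of the truncation. *)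
Definition forward_pos f t x v := if 0 <= t then Num.max (f t x v) 0 else f t x v.

Lemma jointly_measurable_forward_pos f :
  jointly_measurable f -> jointly_measurable (forward_pos f).
Proof.
move=> mf; apply: measurable_fun_ifT => //.
- apply: measurable_fun_ler => //.
  by apply: measurableT_comp measurable_fst _; exact: measurable_fst.
- by apply: measurable_maxr => //.
Qed.

Lemma max0_lip a b : `|Num.max a 0 - Num.max b 0| <= `|a - b|.
Proof.
by rewrite /Num.max; do 2 case: ltP => ?; rewrite ler_norml; apply/andP; split;
  have := ler_norm (a - b); have := ler_norm (b - a); rewrite (distrC b); lra.
Qed.

Lemma forward_pos_lip f (g : R -> R -> R -> R) t x v :
  `|forward_pos f t x v - forward_pos g t x v| <= `|f t x v - g t x v|.
Proof. by rewrite /forward_pos; case: ifP => // _; exact: max0_lip. Qed.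

Lemma forward_pos_norm f t x v : `|forward_pos f t x v| <= `|f t x v|.
Proof.
rewrite /forward_pos; case: ifP => // _.
by have := max0_lip (f t x v) 0; rewrite maxxx !subr0.
Qed.

(* No loss term contributes where the truncated solution vanishes, so the
   truncated equation cannot push a solution below zero. *)
Lemma C6_forward_pos_ge0 f t x v : jointly_measurable f -> 0 <= t -> f t x v <= 0 ->
  0 <= C6 (forward_pos f) t x v.
Proof.
move=> mf t0 fle; rewrite C6E; last exact: jointly_measurable_forward_pos.
apply: Rintegral_ge0 => u _; apply: Rintegral_ge0 => z _.
have h0 y w : 0 <= forward_pos f t y w by rewrite /forward_pos t0 le_max lexx orbT.
have hv : forward_pos f t x v = 0 by rewrite /forward_pos t0; apply/max_idPr.
rewrite /collision_kernel /C6_integrand hv !(mul0r, add0r, subr0).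
rewrite mulr_ge0// divr_ge0//; last by rewrite mulr_ge0// sqrtr_ge0.
by rewrite mulr_ge0 ?mulr_ge0.
Qed.

End ForwardPositivity.

(** * Well-posedness *)

Section Wellposed.
Context {R : realType} (al be : R) (al0 : 0 < al) (be0 : 0 < be).
Local Notation W := (gauss al be).
Local Notation integral0 := Defs.integral0.
Local Notation bounded_by := (bounded_by al be).
Implicit Types (f g : R -> R -> R -> R) (s t x v y M : R).

Lemma weight_gauss t x v : weight al be (x - t * v) v * W t x v = 1.
Proof. by rewrite /weight /gauss -expRD subrr expR0. Qed.

(** Substituting [x - t * v] for [x] undoes the transport and turns the norm into a pointwise
    Gaussian bound. *)
Lemma normM_le (f : R -> R -> R) (M t : R) :
  (normM al be (fun x v => f (x + t * v)%R v) <= M%:E)%E <->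
  forall x v, `|f x v| <= M * W t x v.
Proof.
split=> [fM x v|fM].
  have : ((`|f x v| * weight al be (x - t * v) v)%:E <= M%:E)%E.
    apply: le_trans fM; apply: ereal_sup_ubound; exists (x - t * v, v) => //=.
    by rewrite subrK.
  rewrite lee_fin => /(ler_wpM2r (gauss_ge0 al be t x v)).
  by rewrite -mulrA weight_gauss mulr1.
apply: ge_ereal_sup => _ [[x v] _ <-] /=; rewrite lee_fin.
have w0 : 0 <= weight al be x v by exact: expR_ge0.
apply: le_trans (ler_wpM2r w0 (fM _ _)) _.
rewrite -mulrA [W _ _ _ * _]mulrC -[x in weight _ _ x _](addrK (t * v)).
by rewrite weight_gauss mulr1.
Qed.

Lemma transportN f t x v : transport (- t) f t x v = f t (x + t * v) v.
Proof. by rewrite /transport mulNr opprK. Qed.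

(** The same substitution rewrites the mild equation for [f] itself, with the collision term
    integrated along trajectories. *)
Lemma mild_solutionP (f0 : R -> R -> R) f : mild_solution al be f0 f <->
  [/\ jointly_measurable f, exists2 M, 0 <= M & bounded_by M f &
      forall t x v, f t x v = f0 (x - t * v) v + integral0 (along f t x v) t].
Proof.
have tE t : transport (- t) f t = fun x v => f t (x + t * v) v.
  by apply/funext => x; apply/funext => v; exact: transportN.
have aE t x v : (fun s => transport (- s) (C6 f) s x v) = along f t (x + t * v) v.
  by apply/funext => s; rewrite transportN /along addrK.
split=> [[mf [_ foo] fE]|[mf [M M0 fM] fE]]; split.
- exact: mf.
- have [M M0 fM] : exists2 M, 0 <= M &
      (normLinfM al be (fun t => transport (- t) f t) <= M%:E)%E.
    move: foo; case: (normLinfM _ _ _) => [r _| |_]; first exists `|r| => //.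
    + by rewrite lee_fin ler_norm.
    + by [].
    + by exists 0 => //; rewrite leNye.
  exists M => // t; apply/normM_le; rewrite -tE; apply: le_trans fM.
  by apply: ereal_sup_ubound; exists t.
- by move=> t x v; have := fE t (x - t * v) v; rewrite (aE t) transportN subrK.
- exact: mf.
- split.
    rewrite /jointly_measurable; under eq_fun do rewrite transportN.
    have m1 : measurable_fun setT (fun q : R * R * R => q.1) by exact: measurable_fst.
    have m3 : measurable_fun setT (fun q : R * R * R => q.2) by exact: measurable_snd.
    have m11 := measurableT_comp measurable_fst m1.
    have m12 := measurableT_comp measurable_snd m1.
    apply: measurable_comp3 => //; apply: measurable_funD => //.
    exact: measurable_funM.
  apply: (@le_lt_trans _ _ M%:E); last exact: ltry.
  by apply: ge_ereal_sup => _ [t _ <-]; rewrite tE; apply/normM_le; exact: fM.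
- by move=> t x v; rewrite (aE t) transportN fE addrK.
Qed.

(** Both solutions lie in a common ball, of radius the sum of their bounds. Iterating
    [duhamel_exp_contraction] halves their weighted distance indefinitely. *)
Lemma mild_solution_unique (f0 : R -> R -> R) f g :
  mild_solution al be f0 f -> mild_solution al be f0 g -> f = g.
Proof.
move=> /mild_solutionP[mf [Mf Mf0 fM] fE] /mild_solutionP[mg [Mg Mg0 gM] gE].
pose M := Mf + Mg; have M0 : 0 <= M by rewrite addr_ge0.
have {}fM : bounded_by M f.
  move=> t x v; apply: le_trans (fM t x v) _.
  by rewrite ler_wpM2r ?gauss_ge0// lerDl.
have {}gM : bounded_by M g.
  move=> t x v; apply: le_trans (gM t x v) _.
  by rewrite ler_wpM2r ?gauss_ge0// lerDr.
pose la := 2 * (@collision_const R * M ^+ 4 / be) + 1.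
have la0 : 0 <= la.
  rewrite addr_ge0// mulr_ge0// divr_ge0 ?(ltW be0)//.
  by apply: mulr_ge0; [exact: collision_const_ge0|exact: exprn_ge0].
have close k t x v :
    `|f t x v - g t x v| <= (2 * M / 2 ^+ k) * expR (la * `|t|) * W t x v.
  elim: k t x v => [|k IH] t x v.
    rewrite expr0 divr1; apply: le_trans (ler_normB _ _) _.
    apply: (@le_trans _ _ (2 * M * W t x v)).
      by have := fM t x v; have := gM t x v; lra.
    rewrite ler_wpM2r ?gauss_ge0// ler_peMr ?mulr_ge0//.
    by rewrite -expR0 ler_expR mulr_ge0.
  rewrite fE gE opprD addrACA subrr add0r.
  have D0 : 0 <= 2 * M / 2 ^+ k by rewrite divr_ge0 ?mulr_ge0 ?exprn_ge0.
  apply: le_trans (duhamel_exp_contraction al0 be0 t x v mf mg M0 D0 fM gM IH) _.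
  rewrite le_eqVlt; apply/orP; left; apply/eqP; rewrite -/la exprS.
  by field; rewrite expf_neq0.
apply/funext => t; apply/funext => x; apply/funext => v; apply/eqP.
rewrite -subr_eq0 -normr_le0.
apply: (@le_add_geometric _ _ _ (2 * M * expR (la * `|t|) * W t x v)) => k.
rewrite add0r; apply: le_trans (close k t x v) _.
by rewrite le_eqVlt; apply/orP; left; apply/eqP; ring.
Qed.

(** * Picard iteration for the truncated equation *)

Section Existence.
Context (f0 : R -> R -> R) (rho : R).
Context (mf0 : measurable_fun setT (fun z : R * R => f0 z.1 z.2))
  (f00 : forall x v, 0 <= f0 x v)
  (f0_le : forall x v, `|f0 x v| <= rho * W 0 x v)
  (rho0 : 0 <= rho) (small : time_const al be * (2 * rho) ^+ 4 <= 2^-1).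

Let M := 2 * rho.
Let M0 : 0 <= M. Proof. exact: mulr_ge0. Qed.

Let step f t x v :=
  f0 (x - t * v) v + integral0 (along (forward_pos f) t x v) t.

Let step_measurable f : jointly_measurable f -> jointly_measurable (step f).
Proof.
move=> mf.
have m1 : measurable_fun setT (fun q : R * R * R => q.1) by exact: measurable_fst.
have mv : measurable_fun setT (fun q : R * R * R => q.2) by exact: measurable_snd.
have mt : measurable_fun setT (fun q : R * R * R => q.1.1).
  exact: measurableT_comp measurable_fst m1.
have mx : measurable_fun setT (fun q : R * R * R => q.1.2).
  exact: measurableT_comp measurable_snd m1.
have mtv : measurable_fun setT (fun q : R * R * R => q.1.2 - q.1.1 * q.2).
  by apply: measurable_funB => //; exact: measurable_funM.
apply: measurable_funD.
  exact: (measurableT_comp mf0 (measurable_fun_pair mtv mv)).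
apply: (@measurable_integral0 R _ (R * R * R)%type
  (fun q => along (forward_pos f) q.1.1 q.1.2 q.2) (fun q => q.1.1)) => //.
have mq1 : measurable_fun setT (fun q : (R * R * R) * R => q.1).
  exact: measurable_fst.
have ms : measurable_fun setT (fun q : (R * R * R) * R => q.2) by exact: measurable_snd.
apply: measurable_comp3 => //.
- exact: (jointly_measurable_C6 (jointly_measurable_forward_pos mf)).
- apply: measurable_funD; first exact: measurableT_comp mtv mq1.
  by apply: measurable_funM => //; exact: measurableT_comp mv mq1.
- exact: measurableT_comp mv mq1.
Qed.

Let f0_bound t x v : `|f0 (x - t * v) v| <= rho * W t x v.
Proof. by apply: le_trans (f0_le _ _) _; rewrite /gauss mul0r subr0. Qed.

Let forward_pos_bounded f : bounded_by M f -> bounded_by M (forward_pos f).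
Proof. by move=> fM t x v; apply: le_trans (forward_pos_norm _ _ _ _) (fM t x v). Qed.

(** Half of [M = 2 * rho] is spent on the initial data; [small] bounds the Duhamel term by the other
    half. *)
Let step_bounded f : jointly_measurable f -> bounded_by M f -> bounded_by M (step f).
Proof.
move=> mf fM t x v; apply: le_trans (ler_normD _ _) _.
have h1 := f0_bound t x v.
have h2 := duhamel_bounded al0 be0 t x v (jointly_measurable_forward_pos mf) M0
  (forward_pos_bounded fM).
have h3 : time_const al be * M ^+ 5 * W t x v <= rho * W t x v.
  rewrite ler_wpM2r ?gauss_ge0// exprSr mulrA.
  apply: le_trans (ler_wpM2r M0 small) _.
  by rewrite /M mulrA mulVf// mul1r.
by rewrite /M; move: h1 h2 h3; lra.
Qed.

(** Truncation does not increase distances, so [small] directly yields the factor 1/2. *)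
Let step_contraction f g D : jointly_measurable f -> jointly_measurable g ->
  bounded_by M f -> bounded_by M g -> 0 <= D ->
  (forall t x v, `|f t x v - g t x v| <= D * W t x v) ->
  forall t x v, `|step f t x v - step g t x v| <= D / 2 * W t x v.
Proof.
move=> mf mg fM gM D0 fgD t x v; rewrite /step opprD addrACA subrr add0r.
apply: le_trans (duhamel_contraction al0 be0 t x v
  (jointly_measurable_forward_pos mf) (jointly_measurable_forward_pos mg) M0 D0
  (forward_pos_bounded fM) (forward_pos_bounded gM) _) _.
  by move=> s y u; apply: le_trans (forward_pos_lip _ _ _ _ _) (fgD s y u).
rewrite ler_wpM2r ?gauss_ge0// mulrC; apply: ler_wpM2l => //.
Qed.

Let picard n : R -> R -> R -> R := iter n step (fun _ _ _ => 0).

Let picard_ok n : jointly_measurable (picard n) /\ bounded_by M (picard n).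
Proof.
elim: n => [|n [mn bn]].
  split; first exact: jointly_measurable0.
  by move=> t x v; rewrite normr0 mulr_ge0 ?gauss_ge0.
by split; [exact: step_measurable|exact: step_bounded].
Qed.

Let picard_step n t x v :
  `|picard n.+1 t x v - picard n t x v| <= M / 2 ^+ n * W t x v.
Proof.
elim: n t x v => [|n IH] t x v.
  (* The zeroth iterate is 0, so the first increment is the first iterate itself. *)
  by rewrite subr0 expr0 divr1; have [_] := picard_ok 1; exact.
have [m1 b1] := picard_ok n.+1; have [m2 b2] := picard_ok n.
have D0 : 0 <= M / 2 ^+ n by rewrite divr_ge0 ?exprn_ge0.
apply: le_trans (step_contraction m1 m2 b1 b2 D0 IH t x v) _.
by rewrite exprS invfM [2^-1 * _]mulrC mulrA.
Qed.

Let sol t x v := limn (fun n => picard n t x v).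

Let picard_cvg t x v : cvgn (fun n => picard n t x v) /\
  forall n, `|sol t x v - picard n t x v| <= 2 * M / 2 ^+ n * W t x v.
Proof.
have [|c h] := @geometric_cvg R (fun n => picard n t x v) (M * W t x v).
  by move=> n; rewrite mulrAC; exact: picard_step.
by split => // n; apply: le_trans (h n) _; rewrite mulrA mulrAC.
Qed.

Let sol_measurable : jointly_measurable sol.
Proof.
apply: (@measurable_fun_cvg _ _ _ _ (fun n q => picard n q.1.1 q.1.2 q.2)).
  by move=> n; have [] := picard_ok n.
by move=> [[t x] v] _; have [] := picard_cvg t x v.
Qed.

Let sol_bounded : bounded_by M sol.
Proof.
move=> t x v; apply: (@le_add_geometric _ _ _ (2 * M * W t x v)) => n.
have [_ /(_ n) h2] := picard_cvg t x v; have [_ /(_ t x v) h1] := picard_ok n.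
rewrite -(subrK (picard n t x v) (sol t x v)); apply: le_trans (ler_normD _ _) _.
rewrite addrC (mulrAC (2 * M) (W t x v)).
exact: lerD.
Qed.

(** Both [sol] and [step sol] are close to the iterate of index [n.+1], the latter by contraction.
    No limit has to be exchanged with an integral. *)
Let sol_fixed t x v : sol t x v = step sol t x v.
Proof.
apply/eqP; rewrite -subr_eq0 -normr_le0.
apply: (@le_add_geometric _ _ _ (2 * M * W t x v)) => n; rewrite add0r.
have [_ /(_ n.+1) h1] := picard_cvg t x v; have [mn bn] := picard_ok n.
have D0 : 0 <= 2 * M / 2 ^+ n by rewrite divr_ge0 ?mulr_ge0 ?exprn_ge0.
have h2 := step_contraction sol_measurable mn sol_bounded bn D0
  (fun t x v => (picard_cvg t x v).2 n) t x v.
rewrite -[step sol t x v](subrK (picard n.+1 t x v)) opprD addrA addrAC.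
apply: le_trans (ler_normB _ _) _; apply: le_trans (lerD h1 h2) _.
rewrite le_eqVlt; apply/orP; left; apply/eqP; rewrite exprS.
by field; rewrite expf_neq0.
Qed.

(** Along a trajectory, [sol] is its initial value plus the integral of [g]. By
    [C6_forward_pos_ge0], [g] is nonnegative wherever [sol] is negative, and [ge0_integral0]
    concludes. *)
Let sol_ge0 : nonnegative_solution sol.
Proof.
move=> t x v t0; pose y := x - t * v.
pose g s := C6 (forward_pos sol) s (y + s * v) v.
have alongE s : along (forward_pos sol) s (y + s * v) v = g.
  by apply/funext => r; rewrite /along addrK.
have solE s : sol s (y + s * v) v = f0 y v + integral0 g s.
  by rewrite sol_fixed /step alongE addrK.
have mp := jointly_measurable_forward_pos sol_measurable.
rewrite -[x](subrK (t * v)) -/y solE.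
apply: (@ge0_integral0 _ _ _ (@collision_const R * M ^+ 5 / be)) => //.
- by rewrite -(alongE 0); exact: measurable_along.
- move=> s; apply: (C6_bounded al0 be0 _ _ _ mp M0).
  exact: (forward_pos_bounded sol_bounded).
- move=> s s0; rewrite -solE => /ltW; exact: C6_forward_pos_ge0.
Qed.

Lemma exists_mild_solution :
  exists f, mild_solution al be f0 f /\ nonnegative_solution f.
Proof.
exists sol; split; last exact: sol_ge0.
have posE : forward_pos sol = sol.
  apply/funext => t; apply/funext => x; apply/funext => v; rewrite /forward_pos.
  by case: ifP => // t0; apply/max_idPl/sol_ge0.
apply/mild_solutionP; split; [exact: sol_measurable| |].
  by exists M => //; exact: sol_bounded.
by move=> t x v; rewrite {1}sol_fixed /step posE.
Qed.

End Existence.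

End Wellposed.

(** The square root of [al] in the bound on [rho ^+ 4] cancels the one in [time_const]; the square
    root of [be] is absorbed by [be^-1 + 1]. What remains is at most [K / (15 * (K + 1))]. *)
Lemma time_const_small (R : realType) (al be rho : R) : 0 < al -> 0 < be -> 0 <= rho ->
  rho <= 19 / 20 * (al `^ 8^-1 /
    (240 * C1_beta (pi * (collision_const + 1)) be) `^ 4^-1) ->
  time_const al be * (2 * rho) ^+ 4 <= 2^-1.
Proof.
move=> al0 be0 rho0; set C := C1_beta _ _ => rhole.
pose K := @collision_const R; have K0 : 0 <= K := collision_const_ge0.
have pi0 := @pi_gt0 R.
pose a := Num.sqrt al; pose b := Num.sqrt be.
have a0 : 0 < a by rewrite sqrtr_gt0.
have b0 : 0 < b by rewrite sqrtr_gt0.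
have bE : b ^+ 2 = be by rewrite sqr_sqrtr// ltW.
pose p : R := 2 `^ (- 2^-1).
have p2 : 2^-1 <= p.
  by rewrite /p -[leLHS]powR_inv1//; apply: ler_powR; rewrite ?ler1n//; lra.
have p0 : 0 < p by exact: powR_gt0.
have K1 : 0 < K + 1 by lra.
have C0 : 0 < C.
  rewrite /C /C1_beta -/p -/K; apply: mulr_gt0; last by rewrite addr_gt0 ?invr_gt0.
  by apply: mulr_gt0 => //; exact: mulr_gt0.
(* The fourth power turns [al] to the 1/8 into a square root and removes the fourth root; 19/20 is
   bounded by 1. *)
have rho4 : rho ^+ 4 <= a / (240 * C).
  pose q := al `^ 8^-1 / (240 * C) `^ 4^-1.
  have q0 : 0 <= q by rewrite divr_ge0 ?powR_ge0.
  apply: (@le_trans _ _ (q ^+ 4)).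
    rewrite ler_pXn2r ?nnegrE//; apply: le_trans rhole _.
    by rewrite ler_piMl// ler_pdivrMr// mul1r ler_nat.
  rewrite /q expr_div_n -!powR_mulrn ?powR_ge0// -!powRrM.
  rewrite (_ : 8^-1 * 4%:R = 2^-1); last by field.
  have X0 : 0 <= 240 * C by rewrite mulr_ge0// ltW.
  by rewrite mulVf// powRr1// powR12_sqrt// ltW.
have C_ge : p * pi * (K + 1) * 2 / b <= C.
  (* Arithmetic-geometric mean inequality for 1 and [be^-1]. *)
  have ab : 2 / b <= be^-1 + 1.
    rewrite -bE -subr_ge0 (_ : _ - _ = (1 - b^-1) ^+ 2) ?sqr_ge0//.
    by field; rewrite gt_eqF.
  rewrite (_ : _ / b = p * (pi * (K + 1)) * (2 / b)); last by ring.
  by rewrite /C /C1_beta -/p -/K; apply: ler_wpM2l ab; rewrite !mulr_ge0// ltW.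
rewrite /time_const -/K sqrtrM ?(ltW al0)// -/a -/b exprMn.
apply: (@le_trans _ _ (K * (pi / (a * b)) * (2 ^+ 4 * (a / (240 * C))))).
  have A0 : 0 <= K * (pi / (a * b)) by rewrite mulr_ge0// divr_ge0 ?ltW ?mulr_gt0.
  by rewrite ler_wpM2l// ler_wpM2l// exprn_ge0.
(* The 15 is 240 divided by [2 ^+ 4]. *)
rewrite (_ : _ * _ = K * pi / (15 * (b * C))); last first.
  by field; rewrite !gt_eqF.
have bC : p * pi * (K + 1) * 2 <= b * C by rewrite [leRHS]mulrC -ler_pdivrMr.
rewrite ler_pdivrMr; last by apply: mulr_gt0 => //; exact: mulr_gt0.
apply: (@le_trans _ _ (2^-1 * (15 * (p * pi * (K + 1) * 2)))); last first.
  by rewrite ler_wpM2l ?invr_ge0// ler_wpM2l.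
rewrite (_ : 2^-1 * _ = p * (15 * pi * (K + 1))); last by field.
apply: (@le_trans _ _ (2^-1 * (15 * pi * (K + 1)))).
  have : 0 <= K * pi by rewrite mulr_ge0 ?(ltW pi0).
  lra.
by apply: ler_wpM2r => //; apply: mulr_ge0 (ltW K1); rewrite mulr_ge0// ltW.
Qed.

Theorem theorem2p5 (R : realType) :
  exists C1 : R, 0 < C1 /\
    forall alpha beta Rks : R, 0 < alpha -> 0 < beta -> 0 < Rks ->
      Rks <= 19 / 20 *
        (alpha `^ 8^-1 / (240 * C1_beta C1 beta) `^ 4^-1) ->
      forall f0 : R -> R -> R,
        inM alpha beta f0 ->
        (forall x v, 0 <= f0 x v) ->
        (normM alpha beta f0 <= Rks%:E)%E ->
        exists! f : R -> R -> R -> R,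
          mild_solution alpha beta f0 f /\ nonnegative_solution f.
Proof.
have K0 := @collision_const_ge0 R.
(* The summand 1 makes the constant positive given only [0 <= collision_const]. *)
exists (pi * (collision_const + 1)); split.
  by rewrite mulr_gt0 ?pi_gt0// ltr_wpDl.
move=> al be rho al0 be0 rho0 rhole f0 [mf0 _] f00 f0le.
have f0W x v : `|f0 x v| <= rho * gauss al be 0 x v.
  have [+ _] := normM_le al be f0 rho 0; apply.
  rewrite (_ : (fun _ => _) = f0)//.
  by apply/funext => x'; apply/funext => v'; rewrite mul0r addr0.
have small := time_const_small al0 be0 (ltW rho0) rhole.
have [f [mild pos]] := exists_mild_solution al0 be0 mf0 f00 f0W (ltW rho0) small.
exists f; split=> // g [mildg _].
exact: mild_solution_unique mild mildg.
Qed.
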